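(* Let $p$ be a prime and let $k,n$ be nonnegative integers. (1) If $p\equiv 1 \pmod 3$, then \[B_{3}(p^{k}n+p^{k}-1)=\frac{p^{2k}-1}{p^2-1}B_{3}(pn+p-1)-\frac{p^{2k}-p^2}{p^2-1}B_{3}(n).\] (2) If $p\equiv 2 \pmod 3$, then \[B_{3}(p^{k}n+p^k-1)=\frac{p^{2k}-(-1)^{k}}{p^2+1}B_{3}(pn+p-1)+\frac{p^{2k}+(-1)^{k}p^2}{p^2+1}B_{3}(n).\]
   Context: A partition $\lambda$ of a nonnegative integer is called a $3$-core if none of its hook lengths is divisible by $3$. $B_3(n)$ denotes the number of ordered triples $(\lambda_1,\lambda_2,\lambda_3)$ of partitions, each a $3$-core, whose sizes sum to $n$; equivalently $\sum_{n\ge0}B_3(n)q^n=\frac{(q^3;q^3)_\infty^{9}}{(q;q)_\infty^{3}}$, where $(a;q)_\infty=\prod_{k\ge0}(1-aq^k)$. *)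

(* Defs.v *)
From mathcomp Require Import all_boot all_order all_algebra.
Set Implicit Arguments. Unset Strict Implicit. Unset Printing Implicit Defensive.

Definition conj_part (la : seq nat) (j : nat) : nat := count (fun x => j < x) la.

(* hook length of the cell (i,j) (0-indexed, j < la_i) *)
Definition hook (la : seq nat) (i j : nat) : nat :=
  (nth 0 la i - j - 1) + (conj_part la j - i - 1) + 1.

Definition is_core (t : nat) (la : seq nat) : bool :=
  all (fun i => all (fun j => ~~ (t %| hook la i j)) (iota 0 (nth 0 la i)))
      (iota 0 (size la)).

(* Partitions of m encoded as nonincreasing functions 'I_m -> 'I_m.+1
   (a partition of m has at most m parts, each at most m), padded with zeros. *)
Definition fpart_seq (m : nat) (f : {ffun 'I_m -> 'I_m.+1}) : seq nat :=
  filter (fun x => 0 < x) [seq (f i : nat) | i <- enum 'I_m].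

Definition is_fpart (m : nat) (f : {ffun 'I_m -> 'I_m.+1}) : bool :=
  [forall i : 'I_m, forall j : 'I_m, (i <= j) ==> (f j <= f i)] &&
  (\sum_(i < m) (f i : nat) == m).

Definition c3 (m : nat) : nat :=
  #|[set f : {ffun 'I_m -> 'I_m.+1} | is_fpart f && is_core 3 (fpart_seq f)]|.

Definition B3 (n : nat) : nat :=
  \sum_(a < n.+1) \sum_(b < n.+1) \sum_(c < n.+1)
     (if (a + b + c == n)%N then c3 a * c3 b * c3 c else 0).

(* Main.v *)
Require Import Defs.
From mathcomp Require Import all_boot all_order all_algebra all_field.
From mathcomp Require Import zify ring lra.
Import Order.TTheory GRing.Theory Num.Theory.

(** B_3(n) = sum over d | n+1 of chi((n+1)/d) d^2, where chi is the nontrivial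
    character mod 3; both recurrences follow from this by two-step induction on k.

    A 3-core has beta set {1, 4, ..., 3u-2} union {2, 5, ..., 3v-1}, hence size
    u^2 - u v + v^2 + v, so 3-cores of m correspond to Eisenstein integers of norm
    3m+1 up to units, and their number is K(m) = sum over d | 3m+1 of chi(d).  The
    convolutions (K * K)(n) = sigma(3n+2)/3 and sum_i K(i) sigma(3(n-i)+2) =
    3 sum over d | n+1 of chi((n+1)/d) d^2 are proved in the manner of Liouville: on
    the solutions of a x + b y = N, split by residues mod 3, the bijection
    (a, b, x, y) |-> (a - b, b, x, x + y) from {b < a} to {x < y} cancels all terms
    but those with a = b. *)

Local Open Scope ring_scope.

(** * Divisor sums *)

(** Liouville's method handles sums over [a x + b y = N], that is products of two divisor sums,
    whereas [B3] is a threefold convolution of K. Associating it as K * (K * K) works because the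
    inner convolution collapses to a plain divisor sum, so the outer one has the same shape again.
    The outer sum lives at 3n + 3 and is brought down to n + 1 by
    [eisenstein3 (3 m) = 9 eisenstein3 m], which holds because [chi 3 = 0].

    Counting Eisenstein integers of norm n avoids unique factorisation: this count and 6 times the
    sum of chi over the divisors of n obey the same recurrence for passing from m to p m, whether p
    is inert, ramified or split, and they agree at n = 1.

    The coefficients of the theorem come from f(p^2 m) = (chi(p) + p^2) f(p m) - chi(p) p^2 f(m).
    Its characteristic roots are chi(p) and p^2, whence the denominators p^2 - chi(p). *)

Definition chi (n : nat) : int :=
  if (n %% 3 == 1)%N then 1 else if (n %% 3 == 2)%N then -1 else 0.

Lemma chiM m n : chi (m * n) = chi m * chi n.
Proof.
rewrite /chi -modnMm.
have := ltn_pmod m (isT : 0 < 3)%N; have := ltn_pmod n (isT : 0 < 3)%N.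
by case: (m %% 3)%N (n %% 3)%N => [|[|[|?]]] [|[|[|?]]].
Qed.

Definition dpairs (n : nat) : seq (nat * nat) :=
  [seq (d, n %/ d)%N | d <- divisors n].

Lemma mem_dpairs n q : (0 < n)%N -> (q \in dpairs n) = (q.1 * q.2 == n)%N.
Proof.
move=> n0; apply/mapP/eqP => [[d]|].
  by rewrite -dvdn_divisors // => dn -> /=; rewrite mulnC divnK.
case: q => a b /= E; exists a; rewrite -?dvdn_divisors //.
  by rewrite -E dvdn_mulr.
by rewrite -E mulKn //; move: n0; rewrite -E muln_gt0 => /andP[].
Qed.

Lemma dpairs_uniq n : uniq (dpairs n).
Proof. by rewrite map_inj_uniq ?divisors_uniq // => x y []. Qed.

Definition dconv (g h : nat -> int) (n : nat) : int :=
  \sum_(q <- dpairs n) g q.1 * h q.2.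

Lemma big_bij (R : nmodType) (I J : eqType) (s : seq I) (t : seq J)
    (f : I -> J) (g : J -> I) (F : I -> R) (G : J -> R) :
  uniq s -> uniq t ->
  (forall i, i \in s -> [/\ f i \in t, g (f i) = i & F i = G (f i)]) ->
  (forall j, j \in t -> g j \in s /\ f (g j) = j) ->
  \sum_(i <- s) F i = \sum_(j <- t) G j.
Proof.
move=> us ut fs gt.
have -> : \sum_(i <- s) F i = \sum_(i <- s) G (f i).
  by rewrite !big_seq; apply: eq_bigr => i /fs[].
rewrite -(big_map f predT G); apply: perm_big; apply: uniq_perm => //.
  rewrite map_inj_in_uniq // => i j /fs[_ fi _] /fs[_ fj _] E.
  by rewrite -fi E fj.
move=> j; apply/mapP/idP => [[i /fs[fi _ _] ->] //|/gt[gj E]].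
by exists (g j).
Qed.

Lemma big_bijP (R : nmodType) (I J : eqType) (s : seq I) (t : seq J)
    (P : pred I) (Q : pred J)
    (f : I -> J) (g : J -> I) (F : I -> R) (G : J -> R) :
  uniq s -> uniq t ->
  (forall i, i \in s -> P i -> [/\ f i \in t, Q (f i), g (f i) = i & F i = G (f i)]) ->
  (forall j, j \in t -> Q j -> [/\ g j \in s, P (g j) & f (g j) = j]) ->
  \sum_(i <- s | P i) F i = \sum_(j <- t | Q j) G j.
Proof.
move=> us ut fs gt; rewrite -big_filter -[RHS]big_filter.
apply: (big_bij _ _ _ _ _ f g); rewrite ?filter_uniq //.
  by move=> i; rewrite !mem_filter => /andP[Pi si]; have [-> -> -> ->] := fs i si Pi.
by move=> j; rewrite !mem_filter => /andP[Qj tj]; have [-> -> ->] := gt j tj Qj.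
Qed.

Lemma dconvC g h n : (0 < n)%N -> dconv g h n = dconv h g n.
Proof.
move=> n0.
apply: (big_bij _ _ _ _ _ (fun q => (q.2, q.1)) (fun q => (q.2, q.1)));
  rewrite ?dpairs_uniq //.
  by case=> a b; rewrite !mem_dpairs //= => E; rewrite mulnC mulrC.
by case=> a b; rewrite !mem_dpairs //= => E; rewrite mulnC.
Qed.

(* Split the divisors d of p m according to whether p divides d; the divisors
   prime to p of p m and of m are the same. *)
Lemma dconv_prime (g h : nat -> int) (p m : nat) :
  {morph g : a b / (a * b)%N >-> a * b} ->
  {morph h : a b / (a * b)%N >-> a * b} ->
  prime p -> (0 < m)%N ->
  dconv g h (p * m) = (g p + h p) * dconv g h m
    - g p * h p * (if (p %| m)%N then dconv g h (m %/ p) else 0).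
Proof.
move=> gM hM pr m0; have p0 := prime_gt0 pr.
have S n : (0 < n)%N -> \sum_(q <- dpairs (p * n) | (p %| q.1)%N) g q.1 * h q.2
    = g p * dconv g h n.
  move=> n0; rewrite /dconv big_distrr /=.
  apply: (big_bijP _ _ _ _ _ _ predT (fun q => (q.1 %/ p, q.2)%N)
           (fun q => (p * q.1, q.2)%N)); rewrite ?dpairs_uniq //.
    case=> a b; rewrite !mem_dpairs ?muln_gt0 ?p0 //= => E /dvdnP[c Ec].
    rewrite Ec mulnK //; move: E; rewrite Ec -mulnA (mulnCA c) eqn_pmul2l // => E.
    by rewrite E (mulnC c p) gM mulrA.
  case=> a b; rewrite !mem_dpairs ?muln_gt0 ?p0 //= => /eqP <- _.
  by rewrite mulKn // mulnA dvdn_mulr //.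
have S' n : (0 < n)%N -> \sum_(q <- dpairs (p * n) | ~~ (p %| q.1)%N) g q.1 * h q.2
    = h p * \sum_(q <- dpairs n | ~~ (p %| q.1)%N) g q.1 * h q.2.
  move=> n0; rewrite big_distrr /=.
  apply: (big_bijP _ _ _ _ _ _ _ (fun q => (q.1, q.2 %/ p)%N)
           (fun q => (q.1, p * q.2)%N)); rewrite ?dpairs_uniq //.
    case=> a b; rewrite !mem_dpairs ?muln_gt0 ?p0 //= => /eqP E pa.
    have /dvdnP[c Ec] : (p %| b)%N.
      have : (p %| a * b)%N by rewrite E dvdn_mulr.
      by rewrite Euclid_dvdM // (negPf pa).
    rewrite Ec mulnK //; move: E; rewrite Ec mulnA mulnC => /eqP.
    rewrite eqn_pmul2l // => E.
    by split=> //; rewrite ?(mulnC p) // hM; ring.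
  case=> a b; rewrite !mem_dpairs ?muln_gt0 ?p0 //= => /eqP <- pa.
  by rewrite mulKn // mulnCA.
(* With f for [dconv g h] and T for the part of f(m) with p not dividing d, f(p m) = g(p) f(m) +
   h(p) T and T = f(m) - g(p) f(m/p), the last term being absent unless p divides m. *)
rewrite {1}/dconv (bigID (fun q => p %| q.1)%N) /= S // S' //.
have -> : dconv g h m = \sum_(q <- dpairs m | (p %| q.1)%N) g q.1 * h q.2 +
   \sum_(q <- dpairs m | ~~ (p %| q.1)%N) g q.1 * h q.2.
  by rewrite /dconv (bigID (fun q => p %| q.1)%N).
have -> : \sum_(q <- dpairs m | (p %| q.1)%N) g q.1 * h q.2
   = g p * (if (p %| m)%N then dconv g h (m %/ p) else 0).
  case: ifP => [/dvdnP[n E]|pm].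
    have n0 : (0 < n)%N by move: m0; rewrite E; case: n {E}.
    by rewrite -S // E mulnK // mulnC.
  rewrite mulr0 big_seq_cond big_pred0 // => -[a b]; rewrite mem_dpairs //=.
  by apply/andP=> -[/eqP E pa]; move: pm; rewrite -E dvdn_mulr.
ring.
Qed.

Lemma dconv1 g h : dconv g h 1 = g 1%N * h 1%N.
Proof. by rewrite /dconv /dpairs /= big_seq1. Qed.

(** * Solutions of a x + b y = N *)

(* The positive solutions ((a, x), (b, y)) of a x + b y = N. *)
Definition quads (N : nat) : seq ((nat * nat) * (nat * nat)) :=
  [seq t | i <- iota 1 N.-1,
           t <- [seq (q, r) | q <- dpairs i, r <- dpairs (N - i)]].

Definition quad_pred (N : nat) (t : (nat * nat) * (nat * nat)) :=
  [&& 0 < t.1.1, 0 < t.1.2, 0 < t.2.1, 0 < t.2.2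
    & t.1.1 * t.1.2 + t.2.1 * t.2.2 == N]%N.

Lemma mem_quads N t : (t \in quads N) = quad_pred N t.
Proof.
apply/allpairsPdep/idP => [[i [s [iN + ->]]]|].
  move/allpairsP => [[q r] /= [qi rN ->]]; move: iN qi rN; rewrite mem_iota.
  move=> iN; rewrite !mem_dpairs; [|lia|lia].
  rewrite /quad_pred /= => /eqP E1 /eqP E2.
  have := muln_gt0 q.1 q.2; have := muln_gt0 r.1 r.2; rewrite E1 E2.
  have -> : (0 < i)%N by lia.
  have -> : (0 < N - i)%N by lia.
  by move=> /esym/andP[-> ->] /esym/andP[-> ->] /=; lia.
case: t => [[a x] [b y]] /and5P[/= a0 x0 b0 y0 /eqP E].
have ax : (0 < a * x)%N by rewrite muln_gt0 a0 x0.
have yb : (0 < b * y)%N by rewrite muln_gt0 b0 y0.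
exists (a * x)%N, ((a, x), (b, y)); split=> //.
  by rewrite mem_iota; lia.
apply/allpairsP; exists ((a, x), (b, y)); split=> //=.
  by rewrite mem_dpairs.
by rewrite mem_dpairs -E addKn.
Qed.

Lemma quads_uniq N : uniq (quads N).
Proof.
apply: allpairs_uniq_dep; first exact: iota_uniq.
  move=> i _; apply: allpairs_uniq; rewrite ?dpairs_uniq //.
  by move=> [? ?] [? ?] _ _.
move=> u v; move=> /allpairsPdep[i [s [i1 + ->]]] /allpairsPdep[j [r [j1 + ->]]] /=.
move/allpairsP => [[q1 q2] /= [h _ ->]] /allpairsP [[r1 r2] /= [h' _ ->]].
move=> [e1 e2]; move: h h'; rewrite e1 e2; move: i1 j1; rewrite !mem_iota => i1 j1.
rewrite !mem_dpairs; [|lia|lia].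
by move=> /eqP <- /eqP <-.
Qed.

Definition qsum (N : nat) (f : nat -> nat -> nat -> nat -> int) : int :=
  \sum_(t <- quads N) f t.1.1 t.2.1 t.1.2 t.2.2.

Lemma eq_qsum N f g :
  (forall a b x y, (0 < a)%N -> (0 < b)%N -> (0 < x)%N -> (0 < y)%N ->
     (a * x + b * y = N)%N -> f a b x y = g a b x y) ->
  qsum N f = qsum N g.
Proof.
move=> fg; rewrite /qsum !big_seq; apply: eq_bigr => -[[a x] [b y]].
by rewrite mem_quads => /and5P[/= a0 x0 b0 y0 /eqP E]; apply: fg.
Qed.

Lemma qsumD N f g :
  qsum N (fun a b x y => f a b x y + g a b x y) = qsum N f + qsum N g.
Proof. exact: big_split. Qed.

Lemma qsumN N f : qsum N (fun a b x y => - f a b x y) = - qsum N f.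
Proof. by rewrite /qsum sumrN. Qed.

Lemma qsum_swap N f : qsum N f = qsum N (fun a b x y => f b a y x).
Proof.
rewrite /qsum; apply: (big_bij _ _ _ _ _ (fun t => (t.2, t.1)) (fun t => (t.2, t.1)));
  rewrite ?quads_uniq // => -[[a x] [b y]]; rewrite !mem_quads /quad_pred /=;
  move=> /and5P[-> -> -> -> E]; split=> //; lia.
Qed.

Lemma qsum_flip N f : qsum N f = qsum N (fun a b x y => f x b a y).
Proof.
rewrite /qsum; apply: (big_bij _ _ _ _ _ (fun t => ((t.1.2, t.1.1), t.2))
    (fun t => ((t.1.2, t.1.1), t.2)));
  rewrite ?quads_uniq // => -[[a x] [b y]]; rewrite !mem_quads /quad_pred /=;
  move=> /and5P[-> -> -> -> E]; split=> //; lia.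
Qed.

(* Subtractive Euclid: a x + b y = (a - b) x + b (x + y). *)
Lemma qsum_euclid N f :
  qsum N (fun a b x y => f a b x y *+ (b < a)%N) =
  qsum N (fun a b x y => f (a + b)%N b x (y - x)%N *+ (x < y)%N).
Proof.
rewrite /qsum; under eq_bigr do rewrite mulrb.
under [RHS]eq_bigr do rewrite mulrb.
rewrite -!big_mkcond /=.
apply: (big_bijP _ _ _ _ _ _ _ (fun t => ((t.1.1 - t.2.1, t.1.2), (t.2.1, t.2.2 + t.1.2))%N)
    (fun t => ((t.1.1 + t.2.1, t.1.2), (t.2.1, t.2.2 - t.1.2))%N));
  rewrite ?quads_uniq // => -[[a x] [b y]]; rewrite !mem_quads /quad_pred /=.
  move=> /and5P[a0 x0 b0 y0 /eqP E] ba; rewrite subnK ?addnK //; last exact: ltnW.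
  split=> //; last lia.
  by apply/and5P; split; try lia; apply/eqP; nia.
move=> /and5P[a0 x0 b0 y0 /eqP E] ba; rewrite subnK ?addnK //; last exact: ltnW.
split=> //; last lia.
by apply/and5P; split; try lia; apply/eqP; nia.
Qed.

Lemma qsum_trichotomy N f :
  qsum N f = qsum N (fun a b x y => f a b x y *+ (b < a)%N)
   + qsum N (fun a b x y => f a b x y *+ (a < b)%N)
   + qsum N (fun a b x y => f a b x y *+ (a == b)%N).
Proof.
rewrite -!qsumD; apply: eq_qsum => a b x y _ _ _ _ _.
by case: ltngtP; rewrite ?mulr0n ?mulr1n ?addr0 ?add0r.
Qed.

(** With [a = b] the equation reads a (x + y) = N: choose a divisor pair (a, x + y), then split its
    second entry into two positive parts. *)
Lemma qsum_diag N f : (0 < N)%N ->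
  qsum N (fun a b x y => f a b x y *+ (a == b)%N) =
  \sum_(q <- dpairs N) \sum_(1 <= x < q.2) f q.1 q.1 x (q.2 - x)%N.
Proof.
move=> N0; rewrite /qsum; under eq_bigr do rewrite mulrb.
rewrite -big_mkcond /=.
transitivity (\sum_(t <- [seq (q, x) | q <- dpairs N, x <- index_iota 1 q.2])
    f t.1.1 t.1.1 t.2 (t.1.2 - t.2)%N); last first.
  by rewrite big_allpairs_dep.
apply: (big_bijP _ _ _ _ _ _ predT (fun t => ((t.1.1, t.1.2 + t.2.2), t.1.2)%N)
    (fun t => ((t.1.1, t.2), (t.1.1, t.1.2 - t.2))%N)); rewrite ?quads_uniq //.
- apply: allpairs_uniq_dep; rewrite ?dpairs_uniq //.
    by move=> q _; exact: iota_uniq.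
  by move=> [? ?] [? ?] _ _ /= [-> ->].
- move=> [[a x] [b y]]; rewrite !mem_quads /quad_pred /=.
  move=> /and5P[a0 x0 b0 y0 /eqP E] /eqP ab; subst b; rewrite addKn; split=> //.
  apply/allpairsPdep; exists (a, x + y)%N, x; split=> //=.
    by rewrite mem_dpairs //= mulnDr E.
  by rewrite mem_index_iota; lia.
move=> [[a m] x] /allpairsPdep[[a' m'] [x' [+ + [-> -> ->]]]].
rewrite mem_dpairs // mem_index_iota /= => /eqP E h.
rewrite mem_quads /quad_pred /= subnKC ?eqxx; last lia.
by split=> //; apply/and5P; split; try lia; apply/eqP; nia.
Qed.

(** * Euclid's step on residue classes mod 3 *)

Definition residues (i j k l a b x y : nat) : bool :=
  [&& a %% 3 == i, b %% 3 == j, x %% 3 == k & y %% 3 == l]%N.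

Definition rsum (N i j k l : nat) (w : nat -> nat -> nat -> nat -> int) : int :=
  qsum N (fun a b x y => w a b x y *+ residues i j k l a b x y).

Lemma eq_rsum N i j k l w w' :
  (forall a b x y, (a %% 3 = i)%N -> (b %% 3 = j)%N -> (x %% 3 = k)%N ->
    (y %% 3 = l)%N -> w a b x y = w' a b x y) ->
  rsum N i j k l w = rsum N i j k l w'.
Proof.
move=> E; apply: eq_qsum => a b x y _ _ _ _ _; rewrite !mulrb.
by case: ifP => // /and4P[/eqP ai /eqP bj /eqP xk /eqP yl]; rewrite E.
Qed.

Lemma rsumD N i j k l w w' :
  rsum N i j k l (fun a b x y => w a b x y + w' a b x y) =
  rsum N i j k l w + rsum N i j k l w'.
Proof. by rewrite -qsumD; apply: eq_qsum => *; rewrite mulrnDl. Qed.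

Lemma rsumN N i j k l w :
  rsum N i j k l (fun a b x y => - w a b x y) = - rsum N i j k l w.
Proof. by rewrite -qsumN; apply: eq_qsum => *; rewrite mulNrn. Qed.

Lemma rsum_swap N i j k l w :
  rsum N i j k l w = rsum N j i l k (fun a b x y => w b a y x).
Proof.
rewrite /rsum qsum_swap; apply: eq_qsum => a b x y _ _ _ _ _.
by rewrite /residues andbCA; congr (_ *+ nat_of_bool _); do 2 congr (_ && _); rewrite andbC.
Qed.

Lemma rsum_flip N i j k l w :
  rsum N i j k l w = rsum N k j i l (fun a b x y => w x b a y).
Proof.
rewrite /rsum qsum_flip; apply: eq_qsum => a b x y _ _ _ _ _.
by congr (_ *+ nat_of_bool _); rewrite /residues; do 4 case: eqP => //.
Qed.

Lemma rsum_flip2 N i j k l w :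
  rsum N i j k l w = rsum N i l k j (fun a b x y => w a y x b).
Proof. by rewrite rsum_swap rsum_flip rsum_swap. Qed.

(** [i + 2 * j] is i - j mod 3 written in [nat]. The guards [b < a] and [x < y] keep the truncated
    subtractions exact, and the boolean side condition computes for numeral residues. *)
Lemma rsum_euclid N i j k l i' l' w :
  [&& i < 3, j < 3, k < 3, l < 3, i' == (i + 2 * j) %% 3 & l' == (l + k) %% 3]%N ->
  rsum N i j k l (fun a b x y => w a b x y *+ (b < a)%N) =
  rsum N i' j k l' (fun a b x y => w (a + b)%N b x (y - x)%N *+ (x < y)%N).
Proof.
move=> /and5P[i3 j3 k3 l3 /andP[/eqP -> /eqP ->]].
transitivity (qsum N (fun a b x y =>
   (w a b x y *+ residues i j k l a b x y) *+ (b < a)%N)).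
  by apply: eq_qsum => *; rewrite mulrnAC.
rewrite qsum_euclid; apply: eq_qsum => a b x y _ _ _ _ _.
rewrite mulrnAC; case: ltnP => //= xy; rewrite ?mulr1n ?mulr0n ?mul0rn //.
by congr (_ *+ nat_of_bool _); rewrite /residues; lia.
Qed.

Lemma rsum_trichotomy N i j k l w :
  rsum N i j k l w = rsum N i j k l (fun a b x y => w a b x y *+ (b < a)%N)
   + rsum N i j k l (fun a b x y => w a b x y *+ (a < b)%N)
   + rsum N i j k l (fun a b x y => w a b x y *+ (a == b)%N).
Proof.
rewrite {1}/rsum qsum_trichotomy.
by congr (_ + _ + _); apply: eq_qsum => *; rewrite mulrnAC.
Qed.

(** Distinct residues exclude [a = b], so no diagonal term appears. *)
Lemma rsum_split_ab N i j k l w : i != j ->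
  rsum N i j k l w = rsum N i j k l (fun a b x y => w a b x y *+ (b < a)%N)
   + rsum N i j k l (fun a b x y => w a b x y *+ (a < b)%N).
Proof.
move=> ij; rewrite -rsumD; apply: eq_rsum => a b x y Ei Ej _ _.
case: ltngtP; rewrite ?addr0 ?add0r // => E.
by move: ij; rewrite -Ei -Ej E eqxx.
Qed.

Lemma rsum_split_xy N i j k l w : k != l ->
  rsum N i j k l w = rsum N i j k l (fun a b x y => w a b x y *+ (x < y)%N)
   + rsum N i j k l (fun a b x y => w a b x y *+ (y < x)%N).
Proof.
move=> kl; rewrite -rsumD; apply: eq_rsum => a b x y _ _ Ei Ej.
case: ltngtP; rewrite ?addr0 ?add0r // => E.
by move: kl; rewrite -Ei -Ej E eqxx.
Qed.

Lemma rsum_rev N i j k l w :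
  rsum N i j k l w = rsum N l k j i (fun a b x y => w y x b a).
Proof. by rewrite rsum_swap rsum_flip rsum_flip2. Qed.

(** * Liouville cancellations for the two convolutions *)

Definition cst1 (a b x y : nat) : int := 1.

(* Up to sign the residues (a, b, x, y) are (1, 1, 1, 1) or (1, -1, 1, -1) on the
   left.  Euclid's step turns the parts [b < a] of these classes into the parts
   [x < y] of (0, 1, 1, -1) and (1, 1, -1, 0), which are equinumerous. *)
Lemma qsum_chi_chi n :
  qsum (3 * n + 2) (fun a b x y => chi a * chi b *+ (a * x %% 3 == 1)%N) =
  rsum (3 * n + 2) 1 1 1 1 (fun a b x y => 1 *+ (a == b)%N) +
  rsum (3 * n + 2) 2 2 2 2 (fun a b x y => 1 *+ (a == b)%N).
Proof.
set N := (3 * n + 2)%N.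
(* Since N is 2 mod 3, [a x = 1] forces [b y = 1], so x = a and y = b mod 3 and four classes
   survive. *)
have -> : qsum N (fun a b x y => chi a * chi b *+ (a * x %% 3 == 1)%N) =
    rsum N 1 1 1 1 cst1 + rsum N 2 2 2 2 cst1
     - (rsum N 1 2 1 2 cst1 + rsum N 2 1 2 1 cst1).
  rewrite -!qsumD -qsumN -qsumD; apply: eq_qsum => a b x y _ _ _ _ E.
  have {E}: ((a %% 3) * (x %% 3) + (b %% 3) * (y %% 3) = 2 %[mod 3])%N.
    by rewrite -modnDm !modnMm modnDm E /N; lia.
  rewrite /residues /chi -modnMm /cst1.
  have := ltn_pmod a (isT : 0 < 3)%N; have := ltn_pmod b (isT : 0 < 3)%N.
  have := ltn_pmod x (isT : 0 < 3)%N; have := ltn_pmod y (isT : 0 < 3)%N.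
  by case: (a %% 3)%N (b %% 3)%N (x %% 3)%N (y %% 3)%N
    => [|[|[|?]]] [|[|[|?]]] [|[|[|?]]] [|[|[|?]]].
have swap11 i : rsum N i i i i (fun a b x y => 1 *+ (a < b)%N) =
    rsum N i i i i (fun a b x y => 1 *+ (b < a)%N) by exact: rsum_swap.
have P1 i : rsum N i i i i cst1 = rsum N i i i i (fun a b x y => 1 *+ (b < a)%N) *+ 2
     + rsum N i i i i (fun a b x y => 1 *+ (a == b)%N).
  by rewrite rsum_trichotomy swap11 mulr2n.
have P2 : rsum N 1 2 1 2 cst1 = rsum N 1 2 1 2 (fun a b x y => 1 *+ (b < a)%N)
    + rsum N 2 1 2 1 (fun a b x y => 1 *+ (b < a)%N).
  by rewrite rsum_split_ab //; congr (_ + _); exact: rsum_swap.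
have P2' : rsum N 2 1 2 1 cst1 = rsum N 1 2 1 2 cst1 by exact: rsum_swap.
(* The auxiliary classes (2, 0, 1, 2) and (1, 0, 2, 1) are each counted twice: by comparing x with
   y, and by comparing x with b. Euclid's step carries the [b < x] part of either one to the [x < y]
   part of the other, so adding the equations cancels these parts and equates the remaining ones. *)
have M : rsum N 2 0 1 2 cst1 = rsum N 2 0 1 2 (fun a b x y => 1 *+ (x < y)%N)
    + rsum N 2 0 1 2 (fun a b x y => 1 *+ (y < x)%N) by exact: rsum_split_xy.
have M' : rsum N 1 0 2 1 cst1 = rsum N 1 0 2 1 (fun a b x y => 1 *+ (x < y)%N)
    + rsum N 1 0 2 1 (fun a b x y => 1 *+ (y < x)%N) by exact: rsum_split_xy.
have B1 : rsum N 2 0 1 2 cst1 = rsum N 1 0 2 2 (fun a b x y => 1 *+ (b < a)%N)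
    + rsum N 2 0 1 2 (fun a b x y => 1 *+ (x < b)%N).
  by rewrite rsum_flip rsum_split_ab //; congr (_ + _); exact: rsum_flip.
have B2 : rsum N 1 0 2 1 cst1 = rsum N 2 0 1 1 (fun a b x y => 1 *+ (b < a)%N)
    + rsum N 1 0 2 1 (fun a b x y => 1 *+ (x < b)%N).
  by rewrite rsum_flip rsum_split_ab //; congr (_ + _); exact: rsum_flip.
have T1 : rsum N 1 1 1 1 (fun a b x y => 1 *+ (b < a)%N) =
    rsum N 0 1 1 2 (fun a b x y => 1 *+ (x < y)%N) by exact: rsum_euclid.
have T2 : rsum N 2 2 2 2 (fun a b x y => 1 *+ (b < a)%N) =
    rsum N 0 2 2 1 (fun a b x y => 1 *+ (x < y)%N) by exact: rsum_euclid.
have T3 : rsum N 1 2 1 2 (fun a b x y => 1 *+ (b < a)%N) =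
    rsum N 2 2 1 0 (fun a b x y => 1 *+ (x < y)%N) by exact: rsum_euclid.
have T4 : rsum N 2 1 2 1 (fun a b x y => 1 *+ (b < a)%N) =
    rsum N 1 1 2 0 (fun a b x y => 1 *+ (x < y)%N) by exact: rsum_euclid.
have T5 : rsum N 1 0 2 2 (fun a b x y => 1 *+ (b < a)%N) =
    rsum N 1 0 2 1 (fun a b x y => 1 *+ (x < y)%N) by exact: rsum_euclid.
have T6 : rsum N 2 0 1 1 (fun a b x y => 1 *+ (b < a)%N) =
    rsum N 2 0 1 2 (fun a b x y => 1 *+ (x < y)%N) by exact: rsum_euclid.
have S1 : rsum N 0 1 1 2 (fun a b x y => 1 *+ (x < y)%N) =
   rsum N 1 0 2 1 (fun a b x y => 1 *+ (y < x)%N) by exact: rsum_swap.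
have S2 : rsum N 0 2 2 1 (fun a b x y => 1 *+ (x < y)%N) =
   rsum N 2 0 1 2 (fun a b x y => 1 *+ (y < x)%N) by exact: rsum_swap.
have S3 : rsum N 1 1 2 0 (fun a b x y => 1 *+ (x < y)%N) =
   rsum N 1 0 2 1 (fun a b x y => 1 *+ (x < b)%N) by exact: rsum_flip2.
have S4 : rsum N 2 2 1 0 (fun a b x y => 1 *+ (x < y)%N) =
   rsum N 2 0 1 2 (fun a b x y => 1 *+ (x < b)%N) by exact: rsum_flip2.
rewrite !P1 P2' P2 T1 T2 T3 T4 S1 S2 S3 S4.
move: B1 B2; rewrite T5 T6 M M'; lia.
Qed.

(* On the left there are the classes (1, 1, 1, -1) and (1, -1, 1, 1), counted with
   opposite signs for opposite residues.  Symmetry makes the weight [y] on the left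
   equivalent to [x + y] on the first class and [y - x] on the second; the classes
   (0, 1, 1, 0) and (0, 1, -1, 0) that Euclid's step produces from them cancel, which
   leaves the terms with [a = b]. *)
Lemma qsum_chi_id n :
  qsum (3 * n + 3) (fun a b x y => chi a * y%:Z *+ (a * x %% 3 == 1)%N) =
  rsum (3 * n + 3) 1 1 1 2 (fun a b x y => (x + y)%:Z *+ (a == b)%N) -
  rsum (3 * n + 3) 2 2 2 1 (fun a b x y => (x + y)%:Z *+ (a == b)%N).
Proof.
set N := (3 * n + 3)%N.
pose A (a b x y : nat) : int := a; pose B (a b x y : nat) : int := b.
pose X (a b x y : nat) : int := x; pose Y (a b x y : nat) : int := y.
(* Here N is 0 mod 3, so [a x = 1] forces [b y = -1], that is x = a and y = -b mod 3. *)
have -> : qsum N (fun a b x y => chi a * y%:Z *+ (a * x %% 3 == 1)%N) =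
    rsum N 1 1 1 2 Y - rsum N 2 2 2 1 Y + (rsum N 1 2 1 1 Y - rsum N 2 1 2 2 Y).
  rewrite -!qsumN -!qsumD; apply: eq_qsum => a b x y _ _ _ _ E.
  have {E}: ((a %% 3) * (x %% 3) + (b %% 3) * (y %% 3) = 0 %[mod 3])%N.
    by rewrite -modnDm !modnMm modnDm E /N; lia.
  rewrite /residues /chi -modnMm /Y.
  have := ltn_pmod a (isT : 0 < 3)%N; have := ltn_pmod b (isT : 0 < 3)%N.
  have := ltn_pmod x (isT : 0 < 3)%N; have := ltn_pmod y (isT : 0 < 3)%N.
  by case: (a %% 3)%N (b %% 3)%N (x %% 3)%N (y %% 3)%N
    => [|[|[|?]]] [|[|[|?]]] [|[|[|?]]] [|[|[|?]]] //=; lia.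
have F2 : rsum N 1 2 1 1 Y = rsum N 1 1 1 2 B by exact: rsum_flip2.
have F2' : rsum N 2 1 2 2 Y = rsum N 2 2 2 1 B by exact: rsum_flip2.
have F1 : rsum N 1 2 1 1 X = rsum N 1 1 1 2 X by exact: rsum_flip2.
have F1' : rsum N 2 1 2 2 X = rsum N 2 2 2 1 X by exact: rsum_flip2.
(* By [F1] the weight x has the same sum on both classes, so it may be added on the first and
   subtracted on the second. After Euclid's step x + y becomes x + (y - x) = y. *)
have D1 : rsum N 1 1 1 2 X + rsum N 1 1 1 2 Y =
    rsum N 0 1 1 0 (fun a b x y => y%:Z *+ (x < y)%N) +
    rsum N 0 1 2 0 (fun a b x y => y%:Z *+ (x < y)%N) +
    rsum N 1 1 1 2 (fun a b x y => (x + y)%:Z *+ (a == b)%N).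
  rewrite -rsumD rsum_trichotomy (@rsum_euclid _ 1 1 1 2 0 0) // [X in _ + X + _]rsum_swap.
  rewrite (@rsum_euclid _ 1 1 2 1 0 0 (fun a b x y => (y + x)%:Z)) //.
  by congr (_ + _ + _); apply: eq_rsum => a b x y _ _ _ _;
    case: ltnP => // xy; rewrite /X /Y -?PoszD ?subnK ?subnKC // ltnW.
have D1' : rsum N 2 2 2 1 X + rsum N 2 2 2 1 Y =
    rsum N 0 2 2 0 (fun a b x y => y%:Z *+ (x < y)%N) +
    rsum N 0 2 1 0 (fun a b x y => y%:Z *+ (x < y)%N) +
    rsum N 2 2 2 1 (fun a b x y => (x + y)%:Z *+ (a == b)%N).
  rewrite -rsumD rsum_trichotomy (@rsum_euclid _ 2 2 2 1 0 0) // [X in _ + X + _]rsum_swap.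
  rewrite (@rsum_euclid _ 2 2 1 2 0 0 (fun a b x y => (y + x)%:Z)) //.
  by congr (_ + _ + _); apply: eq_rsum => a b x y _ _ _ _;
    case: ltnP => // xy; rewrite /X /Y -?PoszD ?subnK ?subnKC // ltnW.
have YX i j k l : rsum N i j k l Y - rsum N i j k l X =
    rsum N i j k l (fun a b x y => (y - x)%N%:Z *+ (x < y)%N) -
    rsum N j i l k (fun a b x y => (y - x)%N%:Z *+ (x < y)%N).
  rewrite [in X in _ = _ - X]rsum_swap -!rsumN -!rsumD.
  apply: eq_rsum => a b x y _ _ _ _; rewrite /X /Y.
  by case: ltngtP => h; rewrite ?mulr0n ?mulr1n; lia.
(* Euclid's step read backwards: the weight y - x on [x < y] comes from the weight y on [b < a]. *)
have D2 : rsum N 1 2 1 1 Y - rsum N 1 2 1 1 X =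
    rsum N 0 2 1 0 (fun a b x y => y%:Z *+ (b < a)%N) -
    rsum N 0 1 1 0 (fun a b x y => y%:Z *+ (b < a)%N).
  by rewrite YX; congr (_ - _); symmetry; exact: rsum_euclid.
have D2' : rsum N 2 1 2 2 Y - rsum N 2 1 2 2 X =
    rsum N 0 1 2 0 (fun a b x y => y%:Z *+ (b < a)%N) -
    rsum N 0 2 2 0 (fun a b x y => y%:Z *+ (b < a)%N).
  by rewrite YX; congr (_ - _); symmetry; exact: rsum_euclid.
have O j : (j < 3)%N -> j != 0%N -> rsum N 0 j j 0 (fun a b x y => y%:Z *+ (x < y)%N) =
    rsum N 0 j j 0 (fun a b x y => y%:Z *+ (b < a)%N).
  move=> j3 j0.
  (* Symmetry moves this to the class (j, 0, 0, j) with weight b; there Euclid's step changes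
     neither the residues nor b. *)
  have E : rsum N 0 j j 0 (fun a b x y => y%:Z *+ (y < x)%N) =
      rsum N 0 j j 0 (fun a b x y => a%:Z *+ (y < x)%N).
    rewrite rsum_swap rsum_rev [RHS]rsum_swap.
    by apply: rsum_euclid; rewrite j3; lia.
  have := rsum_split_xy N 0 j j 0 Y j0; rewrite E => E1.
  have := rsum_split_xy N 0 j j 0 A j0.
  have -> : rsum N 0 j j 0 A = rsum N 0 j j 0 Y by exact: rsum_rev.
  rewrite E1 => /addIr ->.
  exact: rsum_rev.
have V j l : (j < 3)%N -> (l < 3)%N -> j != 0%N -> l != 0%N ->
    rsum N 0 j l 0 (fun a b x y => y%:Z *+ (x < y)%N) =
    rsum N 0 j l 0 (fun a b x y => y%:Z *+ (b < a)%N).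
  move=> j3 l3 j0 l0.
  rewrite rsum_swap rsum_rev [RHS]rsum_swap [RHS]rsum_rev.
  (* As b and x are 0 mod 3, Euclid's step preserves this class. Subtracting both sides from the
     total gives the wanted equality between the parts [a < b] and [y < x]. *)
  have E : rsum N l 0 0 j (fun a b x y => b%:Z *+ (b < a)%N) =
      rsum N l 0 0 j (fun a b x y => b%:Z *+ (x < y)%N).
    by apply: rsum_euclid; rewrite l3 j3; lia.
  have := rsum_split_ab N l 0 0 j B l0; rewrite (rsum_split_xy N l 0 0 j B (_ : 0%N != j)).
    by rewrite E => /addrI ->.
  by rewrite eq_sym.
have O1 := O 1%N isT isT; have O2 := O 2%N isT isT.
have V1 := V 1%N 2%N isT isT isT isT; have V2 := V 2%N 1%N isT isT isT isT.
clear V O YX; lia.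
Qed.

(** * Convolution identities *)

Definition chi_sigma (i : nat) : int := \sum_(q <- dpairs (3 * i + 1)) chi q.1.
Definition sigma (n : nat) : int := \sum_(q <- dpairs n) (q.2)%:Z.
(** The coefficient of q^n in the Eisenstein series of weight 3 and character [chi] that equals
    eta(3z)^9 / eta(z)^3; the leading power q of this quotient causes the shift from n to n + 1. *)
Definition eisenstein3 (n : nat) : int := dconv chi (fun d => (d ^ 2)%N%:Z) n.

Lemma sum_mod3 (G : nat -> int) n :
  \sum_(1 <= i < 3 * n + 2 | (i %% 3 == 1)%N) G i = \sum_(c < n.+1) G (3 * c + 1)%N.
Proof.
elim: n => [|n IH].
  by rewrite big_ord_recr big_ord0 big_mkcond /= big_nat1 /= add0r.
rewrite big_ord_recr -IH /= (_ : 3 * n.+1 + 2 = (3 * n + 2).+3)%N; last lia.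
rewrite !big_mkcond !big_nat_recr //=; try lia.
have -> : ((3 * n + 2) %% 3 == 1)%N = false by lia.
have -> : ((3 * n + 2).+1 %% 3 == 1)%N = false by lia.
have -> : ((3 * n + 2).+2 %% 3 == 1)%N by lia.
by rewrite !addr0 -big_mkcond; congr (_ + G _); lia.
Qed.

Lemma sum_mod3S (G : nat -> int) n :
  \sum_(1 <= i < 3 * n + 3 | (i %% 3 == 1)%N) G i = \sum_(c < n.+1) G (3 * c + 1)%N.
Proof.
rewrite -sum_mod3 addnS big_mkcond [RHS]big_mkcond big_nat_recr /=; last lia.
by rewrite (_ : (3 * n + 2) %% 3 == 1 = false)%N ?addr0 //; lia.
Qed.

(** Grouping the solutions by i = a x turns the sum into a convolution of divisor sums. *)
Lemma qsum_conv N (g h : nat -> nat -> int) :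
  qsum N (fun a b x y => g a x * h b y *+ (a * x %% 3 == 1)%N) =
  \sum_(1 <= i < N | (i %% 3 == 1)%N)
     (\sum_(q <- dpairs i) g q.1 q.2) * (\sum_(q <- dpairs (N - i)) h q.1 q.2).
Proof.
rewrite /qsum /quads big_allpairs_dep /= /index_iota subn1 [RHS]big_mkcond.
rewrite !big_seq; apply: eq_bigr => i; rewrite mem_iota => iN.
rewrite big_allpairs /= -mulrb big_distrl /= -sumrMnl.
rewrite [LHS]big_seq [RHS]big_seq; apply: eq_bigr => q.
rewrite mem_dpairs; last lia.
move=> /eqP qi; rewrite big_distrr /= -sumrMnl; apply: eq_bigr => r _.
by rewrite qi.
Qed.

Lemma count_mod3 (m : nat) : (0 < m)%N ->
  \sum_(1 <= x < m) (x %% 3 == 1)%N%:R = ((m + 1) %/ 3)%N%:Z /\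
  \sum_(1 <= x < m) (x %% 3 == 2)%N%:R = (m %/ 3)%N%:Z.
Proof.
case: m => // m _; elim: m => [|m [IH1 IH2]]; first by rewrite !big_geq.
by split; rewrite big_nat_recr //= ?IH1 ?IH2; lia.
Qed.

(** Complementary divisors of a number that is 2 mod 3 have opposite values of [chi], so the sum is
    its own negative. *)
Lemma sum_chi2 n : \sum_(q <- dpairs (3 * n + 2)) chi q.2 = 0.
Proof.
have E : \sum_(q <- dpairs (3 * n + 2)) chi q.2 = \sum_(q <- dpairs (3 * n + 2)) chi q.1.
  have := @dconvC (fun=> 1) chi (3 * n + 2)%N; rewrite addn2 /dconv => /(_ isT) H.
  transitivity (\sum_(q <- dpairs (3 * n).+2) 1 * chi q.2).
    by apply: eq_bigr => *; rewrite mul1r.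
  by rewrite H; apply: eq_bigr => *; rewrite mulr1.
have : \sum_(q <- dpairs (3 * n + 2)) chi q.2 = - \sum_(q <- dpairs (3 * n + 2)) chi q.1.
  rewrite -sumrN !big_seq; apply: eq_bigr => q; rewrite mem_dpairs; last lia.
  move=> /eqP H; have : chi (q.1 * q.2) = - 1.
    by rewrite H /chi (_ : (3 * n + 2) %% 3 = 2)%N //; lia.
  rewrite chiM /chi; by do ?[case: ifP => _]; lia.
by rewrite -E; lia.
Qed.

Lemma conv_chi_sigma2 n :
  3 * (\sum_(c < n.+1) chi_sigma c * chi_sigma (n - c)%N) = sigma (3 * n + 2).
Proof.
have := qsum_conv (3 * n + 2) (fun a _ => chi a) (fun b _ => chi b).
rewrite qsum_chi_chi sum_mod3.
have -> : \sum_(c < n.+1) (\sum_(q <- dpairs (3 * c + 1)) chi q.1) *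
    (\sum_(q <- dpairs (3 * n + 2 - (3 * c + 1))) chi q.1) =
    \sum_(c < n.+1) chi_sigma c * chi_sigma (n - c)%N.
  apply: eq_bigr => c _; rewrite /chi_sigma; congr (_ * \sum_(q <- dpairs _) _).
  by have := ltn_ord c; lia.
move=> <-.
have R r : rsum (3 * n + 2) r r r r (fun a b x y => 1 *+ (a == b)%N) =
  \sum_(q <- dpairs (3 * n + 2)) \sum_(1 <= x < q.2)
    (residues r r r r q.1 q.1 x (q.2 - x)%N)%:R.
  transitivity (qsum (3 * n + 2) (fun a b x y =>
      (residues r r r r a b x y)%:R *+ (a == b)%N)).
    by apply: eq_qsum => *; rewrite mulrnAC.
  by rewrite qsum_diag //; lia.
rewrite !R -big_split /= big_distrr /=.
(* Three times the inner count is q.2 - chi(q.2); inserting the vanishing [chi] sum makes the two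
   sides agree term by term. *)
have -> : sigma (3 * n + 2) = \sum_(q <- dpairs (3 * n + 2)) (q.2%:Z - chi q.2).
  by rewrite sumrB sum_chi2 subr0.
rewrite [LHS]big_seq [RHS]big_seq; apply: eq_bigr => -[a m].
rewrite mem_dpairs /=; last lia.
move=> /eqP E.
have m0 : (0 < m)%N by nia.
have [c1 c2] := count_mod3 m m0.
have : ((a %% 3) * (m %% 3) = 2 %[mod 3])%N by rewrite modnMm E; lia.
have := ltn_pmod a (isT : 0 < 3)%N; have := ltn_pmod m (isT : 0 < 3)%N.
have S r : \sum_(1 <= x < m) (residues r r r r a a x (m - x)%N)%:R =
   ((a %% 3 == r) && (m %% 3 == (r + r) %% 3))%N%:R * \sum_(1 <= x < m) (x %% 3 == r)%N%:R :> int.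
  rewrite big_distrr /=; apply: eq_big_nat => x xm.
  by rewrite -natrM mulnb /residues; congr (nat_of_bool _)%:R; lia.
rewrite !S c1 c2 /chi.
have := divn_eq m 3.
case: (a %% 3)%N => [|[|[|?]]] //; case: (m %% 3)%N => [|[|[|?]]] //= H _ _ _; lia.
Qed.

Lemma conv_chi_sigma3 n :
  \sum_(c < n.+1) chi_sigma c *
    (\sum_(d < (n - c).+1) chi_sigma d * chi_sigma (n - c - d)%N) = eisenstein3 n.+1.
Proof.
have := qsum_conv (3 * n + 3) (fun a _ => chi a) (fun _ y => y%:Z).
rewrite qsum_chi_id sum_mod3S.
have -> : \sum_(c < n.+1) (\sum_(q <- dpairs (3 * c + 1)) chi q.1) *
    (\sum_(q <- dpairs (3 * n + 3 - (3 * c + 1))) q.2%:Z) =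
    3 * \sum_(c < n.+1) chi_sigma c *
      (\sum_(d < (n - c).+1) chi_sigma d * chi_sigma (n - c - d)%N).
  rewrite big_distrr /=; apply: eq_bigr => c _; rewrite mulrCA conv_chi_sigma2.
  rewrite /chi_sigma /sigma; congr (_ * \sum_(q <- dpairs _) _).
  by have := ltn_ord c; lia.
move=> H.
(* The 9 absorbs two factors 3, one from [conv_chi_sigma2] and one from [H2] below. *)
have : eisenstein3 (3 * n.+1) = 9 * eisenstein3 n.+1.
  by rewrite /eisenstein3 dconv_prime // ?mul0r ?add0r ?subr0 //;
    first exact: chiM; move=> a b; rewrite expnMn PoszM.
rewrite /eisenstein3 /dconv => H'.
suff H2 : \sum_(q <- dpairs (3 * n.+1)) chi q.1 * (q.2 ^ 2)%N%:Z = 3 *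
  (rsum (3 * n + 3) 1 1 1 2 (fun a b x y => (x + y)%:Z *+ (a == b)%N) -
  rsum (3 * n + 3) 2 2 2 1 (fun a b x y => (x + y)%:Z *+ (a == b)%N)).
  by move: H'; rewrite H2 H; lia.
have R r s : rsum (3 * n + 3) r r r s (fun a b x y => (x + y)%N%:Z *+ (a == b)%N) =
  \sum_(q <- dpairs (3 * n + 3)) \sum_(1 <= x < q.2)
    (q.2)%:Z * (residues r r r s q.1 q.1 x (q.2 - x)%N)%:R.
  transitivity (qsum (3 * n + 3) (fun a b x y =>
      (x + y)%N%:Z * (residues r r r s a b x y)%:R *+ (a == b)%N)).
    by apply: eq_qsum => *; rewrite mulrnAC mulr_natr.
  rewrite qsum_diag; last lia.
  by apply: eq_bigr => q _; apply: eq_big_nat => x xm; rewrite subnKC //; lia.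
rewrite !R -sumrB big_distrr /=.
rewrite (_ : 3 * n.+1 = 3 * n + 3)%N; last lia.
rewrite [LHS]big_seq [RHS]big_seq; apply: eq_bigr => -[a m].
rewrite mem_dpairs /=; last lia.
move=> /eqP E.
have m0 : (0 < m)%N by nia.
have [c1 c2] := count_mod3 m m0.
(* If 3 divides a, both sides vanish; otherwise 3 divides m, and the classes 1 and 2 each have m/3
   members below m. *)
have : ((a %% 3) * (m %% 3) = 0 %[mod 3])%N by rewrite modnMm E; lia.
have := ltn_pmod a (isT : 0 < 3)%N; have := ltn_pmod m (isT : 0 < 3)%N.
have S r s : (r < 3)%N -> (s < 3)%N ->
   \sum_(1 <= x < m) m%:Z * (residues r r r s a a x (m - x)%N)%:R =
   m%:Z * (((a %% 3 == r) && (m %% 3 == (r + s) %% 3))%N%:R *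
     \sum_(1 <= x < m) (x %% 3 == r)%N%:R) :> int.
  move=> r3 s3; rewrite -big_distrr /=; congr (_ * _); rewrite big_distrr /=; apply: eq_big_nat => x xm.
  rewrite -natrM mulnb /residues; congr (nat_of_bool _)%:R; lia.
rewrite !S // c1 c2 /chi.
have := divn_eq m 3.
case: (a %% 3)%N => [|[|[|?]]] //; case: (m %% 3)%N => [|[|[|?]]] //= H0 _ _ _; try lia;
  (have -> : ((m + 1) %/ 3 = m %/ 3)%N by lia);
  move: H0; rewrite addn0; set t := (m %/ 3)%N => ->; lia.
Qed.

(** * Eisenstein integers of given norm *)

(* The pair (a, b) stands for the Eisenstein integer a + b w, w^2 + w + 1 = 0. *)
Definition enorm (z : int * int) : int := z.1 ^+ 2 - z.1 * z.2 + z.2 ^+ 2.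
Definition emul (z w : int * int) : int * int :=
  (z.1 * w.1 - z.2 * w.2, z.1 * w.2 + z.2 * w.1 - z.2 * w.2).
Definition econj (z : int * int) : int * int := (z.1 - z.2, - z.2).

Lemma enormM z w : enorm (emul z w) = enorm z * enorm w.
Proof. rewrite /enorm /emul /=; ring. Qed.

Lemma enorm_conj z : enorm (econj z) = enorm z.
Proof. rewrite /enorm /econj /=; ring. Qed.

Definition zrange (n : nat) : seq int := [seq i%:Z - n%:Z | i <- iota 0 (n.*2.+1)].

Lemma mem_zrange n x : (x \in zrange n) = (`|x| <= n%:Z).
Proof.
apply/mapP/idP => [[i]|h]; first by rewrite mem_iota => ? ->; lia.
by exists (absz (x + n%:Z)); rewrite ?mem_iota; lia.
Qed.

Lemma zrange_uniq n : uniq (zrange n).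
Proof. by rewrite map_inj_uniq ?iota_uniq // => i j; lia. Qed.

(** The box is large enough: 3 u^2 + (2 v - u)^2 = 4 n gives |u| <= u^2 <= 2 n for each
    coordinate. *)
Definition eisenstein_of_norm (n : nat) : seq (int * int) :=
  [seq z <- [seq (x, y) | x <- zrange n.*2, y <- zrange n.*2] | enorm z == n%:Z].

Lemma eisenstein_of_norm_uniq n : uniq (eisenstein_of_norm n).
Proof.
rewrite filter_uniq // allpairs_uniq ?zrange_uniq //.
by move=> [? ?] [? ?] _ _.
Qed.

Lemma mem_eisenstein_of_norm n z :
  (z \in eisenstein_of_norm n) = (enorm z == n%:Z).
Proof.
rewrite mem_filter andb_idr //; case: z => x y /eqP; rewrite /enorm [_.1]/= [_.2]/= => E.
have bound (u v : int) : u ^+ 2 - u * v + v ^+ 2 = n%:Z -> `|u| <= n.*2%:Z.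
  move=> H; have : 3 * u ^+ 2 + (2 * v - u) ^+ 2 = 4 * n%:Z by rewrite -H; ring.
  have s0 := sqr_ge0 (2 * v - u).
  have : u ^+ 2 = `|u| * `|u| by rewrite -normrM -expr2 ger0_norm ?sqr_ge0.
  have : `|u| <= `|u| * `|u|.
    by have [->|u0] := eqVneq u 0; rewrite ?normr0 // ler_peMr //; lia.
  move: (_ ^+ 2) (_ ^+ 2) (`|u| * `|u|) s0 => A B C; lia.
apply/allpairsP; exists (x, y); split=> //; rewrite mem_zrange.
  exact: (bound x y).
by apply: (bound y x); rewrite -E [_ + y ^+ 2]addrC addrA [y * x]mulrC addrAC.
Qed.

Definition reps (n : nat) : nat := size (eisenstein_of_norm n).

Lemma count_bij (I J : eqType) (s : seq I) (t : seq J) (P : pred I) (Q : pred J)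
    (f : I -> J) (g : J -> I) :
  uniq s -> uniq t ->
  (forall i, i \in s -> P i -> [/\ f i \in t, Q (f i) & g (f i) = i]) ->
  (forall j, j \in t -> Q j -> [/\ g j \in s, P (g j) & f (g j) = j]) ->
  count P s = count Q t.
Proof.
move=> us ut fs gt; rewrite -!sum1_count.
by apply: (big_bijP _ _ _ _ _ _ _ f g) => // i si Pi; have [] := fs i si Pi.
Qed.

Definition edvd (p : nat) (z : int * int) : bool := (p %| z.1)%Z && (p %| z.2)%Z.

(** Division by p divides the norm by p^2, and p m / p^2 = m / p. *)
Lemma count_edvd p m : (0 < p)%N -> (0 < m)%N ->
  count (edvd p) (eisenstein_of_norm (p * m)) =
  if (p %| m)%N then reps (m %/ p) else 0%N.
Proof.
move=> p0 m0; case: ifP => [/dvdnP[k E]|pm].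
  rewrite /reps -count_predT E mulnK //.
  apply: (count_bij _ _ _ _ _ _ (fun z => (z.1 %/ p, z.2 %/ p)%Z)
     (fun z => (z.1 * p%:Z, z.2 * p%:Z))); rewrite ?eisenstein_of_norm_uniq //.
    case=> x y; rewrite !mem_eisenstein_of_norm => + /andP[/= px py].
    move: (px) (py) => /dvdzP[c ->] /dvdzP[d ->].
    rewrite !mulzK; try lia.
    rewrite /enorm /= => /eqP H; split=> //; apply/eqP.
    apply: (@mulfI _ (p%:Z ^+ 2)); first by rewrite expf_neq0 //; lia.
    by transitivity (p * (k * p))%N%:Z; [rewrite -H|rewrite !PoszM]; ring.
  case=> x y; rewrite !mem_eisenstein_of_norm /enorm /= /edvd /= => /eqP H _.
  rewrite !dvdz_mull // !mulzK; try lia.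
  split=> //; apply/eqP; rewrite !PoszM -H; ring.
apply/eqP; rewrite -leqn0 leqNgt -has_count; apply/hasPn => -[x y].
rewrite mem_eisenstein_of_norm /enorm /= => /eqP H.
apply/negP => /andP[/= /dvdzP[c E] /dvdzP[d E']]; move: pm => /negP; apply.
have E2 : m%:Z = (c ^+ 2 - c * d + d ^+ 2) * p%:Z.
  apply: (@mulfI _ p%:Z); first by lia.
  rewrite -PoszM -H E E'; ring.
have : (p%:Z %| m%:Z)%Z by rewrite E2 dvdz_mull.
by rewrite dvdzE.
Qed.

(** * Rational primes in the Eisenstein integers *)

Lemma Fp_int_eq0 (p : nat) (a : int) : prime p -> (a%:~R == 0 :> 'F_p) = (p %| a)%Z.
Proof.
move=> pr; have H n : (n%:R == 0 :> 'F_p) = (p %| n)%N.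
  by rewrite (dvdn_pcharf (pchar_Fp pr)).
by case: a => n; rewrite dvdzE ?NegzE ?rmorphN ?oppr_eq0 ?abszN; apply: H.
Qed.

(** A zero of the norm form mod p satisfies a^3 = -b^3, and cubing is injective on ['F_p] when p is
    2 mod 3. So a and b agree up to sign, which makes both zero. *)
Lemma edvd_inert p z : prime p -> (p %% 3 = 2)%N -> (p %| enorm z)%Z -> edvd p z.
Proof.
move=> pr p3; case: z => x y; rewrite /edvd /enorm /= -!Fp_int_eq0 //.
rewrite rmorphD rmorphB !rmorphXn rmorphM /=.
move: (x%:~R : 'F_p) (y%:~R : 'F_p) => {x y} a b /eqP E.
have {E} ab : b ^+ 2 = a * b - a ^+ 2.
  by apply/eqP; rewrite -subr_eq0 -E; apply/eqP; ring.
have n3 : 3 != 0 :> 'F_p.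
  by rewrite -(dvdn_pcharf (pchar_Fp pr)) dvdn_prime2 //; lia.
have a3 : a ^+ 3 = - b ^+ 3.
  by rewrite [b ^+ 3]exprS ab mulrBr mulrCA -expr2 ab; ring.
(* Fermat's c = c^p with p = 3 (p / 3) + 2. *)
have Fm (c : 'F_p) : c = c ^+ 2 * (c ^+ 3) ^+ (p %/ 3).
  by rewrite -{1}(expf_card c) card_Fp // -exprM -exprD; congr (_ ^+ _); lia.
have Eab : a * b ^+ 2 = a ^+ 2 * (-1) ^+ (p %/ 3) * b.
  rewrite {1}(Fm a) {2}(Fm b) a3 -[- _]mulN1r exprMn; ring.
have b0 : b == 0.
  apply/negPn/negP => b0.
  have a0 : a != 0.
    by apply: contra b0 => /eqP a0; rewrite -sqrf_eq0 ab a0 mul0r expr0n subrr.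
  have Eb : b = a * (-1) ^+ (p %/ 3).
    by apply: (mulfI a0); apply: (mulIf b0); rewrite -mulrA -expr2 Eab; ring.
  have a2 : a ^+ 2 != 0 by rewrite sqrf_eq0.
  (* The parity of p / 3 is left open: the norm is 3 a^2 or a^2, and 3 is invertible mod p. *)
  move: ab; rewrite Eb -signr_odd; case: odd; rewrite ?expr0 ?expr1 => H.
    move/negP: a2; apply; rewrite -(inj_eq (mulfI n3)) mulr0; apply/eqP.
    by transitivity ((a * -1) ^+ 2 - (a * (a * -1) - a ^+ 2)); [ring|rewrite H subrr].
  move/negP: a2; apply; apply/eqP.
  by transitivity ((a * 1) ^+ 2 - (a * (a * 1) - a ^+ 2)); [ring|rewrite H subrr].
have := expf_eq0 a 3; rewrite a3 (eqP b0) expr0n oppr0 eqxx /= => <-.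
by [].
Qed.

(** With p = 3k + 1, X^k - 1 has too few roots to kill every unit, so some g^k is a nontrivial cube
    root of unity; r is its negative. This makes r + w an element of norm divisible by p. *)
Lemma exists_norm_multiple p : prime p -> (p %% 3 = 1)%N ->
  exists2 r : int, 0 <= r < p%:Z & (p %| r ^+ 2 - r + 1)%Z.
Proof.
move=> pr p3; have p1 := prime_gt1 pr.
have [k pk] : exists k, p = (3 * k).+1 by exists (p %/ 3)%N; lia.
have k0 : (0 < k)%N by lia.
have [g g0 gk] : exists2 g : 'F_p, g != 0 & g ^+ k != 1.
  case: (pickP (fun g : 'F_p => (g != 0) && (g ^+ k != 1))) => [g /andP[]|H]; first by exists g.
  have P0 : 'X^k - 1 != 0 :> {poly 'F_p} by rewrite -size_poly_eq0 size_XnsubC.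
  have R : all (root ('X^k - 1)) (enum (predC1 (0 : 'F_p))).
    apply/allP => g; rewrite mem_enum !inE => g0.
    have := H g; rewrite g0 /= => /negbFE/eqP gk.
    by rewrite /root !hornerE gk subrr.
  have := max_poly_roots P0 R (enum_uniq _).
  by rewrite size_XnsubC // -cardE cardC1 card_Fp // pk; lia.
pose w := - g ^+ k.
have w3 : w ^+ 2 - w + 1 = 0.
  have : (g ^+ k) ^+ 3 = 1.
    apply: (mulfI g0); rewrite -exprM -exprS mulr1 mulnC -pk -{2}(expf_card g) card_Fp //.
  move=> E; apply: (@mulfI _ (g ^+ k - 1)); first by rewrite subr_eq0.
  by rewrite mulr0; transitivity ((g ^+ k) ^+ 3 - 1); [rewrite /w; ring|rewrite E subrr].
exists (nat_of_ord w)%:Z.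
  by have := ltn_ord w; rewrite [X in (_ < X)%N](Fp_cast pr); lia.
rewrite -Fp_int_eq0 // rmorphD rmorphB rmorphXn /= -[_%:~R]/((nat_of_ord w)%:R) natr_Zp.
by rewrite w3.
Qed.

Lemma centered_residue (a : int) (c : nat) : (0 < c)%N ->
  exists q b : int, a = b + c%:Z * q /\ 4 * b ^+ 2 <= c%:Z ^+ 2.
Proof.
move=> c0; pose r := (a %% c%:Z)%Z; pose q := (a %/ c%:Z)%Z.
have E : a = q * c%:Z + r by exact: divz_eq.
have r0 : 0 <= r by apply: modz_ge0; lia.
have rc : r < c%:Z by apply: ltz_pmod; lia.
have [h|h] := lerP (2 * r) c%:Z.
  by exists q, r; split; [rewrite E; ring|nia].
by exists (q + 1), (r - c%:Z); split; [rewrite E; ring|nia].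
Qed.

Lemma enorm_ge0 z : 0 <= enorm z.
Proof.
have := sqr_ge0 (2 * z.1 - z.2); have := sqr_ge0 z.2.
have : 4 * enorm z = (2 * z.1 - z.2) ^+ 2 + 3 * z.2 ^+ 2 by rewrite /enorm; ring.
lia.
Qed.

Lemma enorm_eq0 z : enorm z = 0 -> z = (0, 0).
Proof.
case: z => x y E; have := sqr_ge0 (2 * x - y); have := sqr_ge0 y.
have : 4 * enorm (x, y) = (2 * x - y) ^+ 2 + 3 * y ^+ 2 by rewrite /enorm /=; ring.
rewrite E => H1 H2 H3.
have /eqP : y ^+ 2 = 0 by lia.
rewrite sqrf_eq0 => /eqP y0.
have /eqP : x ^+ 2 = 0 by rewrite -E /enorm y0 /=; ring.
by rewrite sqrf_eq0 y0 => /eqP ->.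
Qed.

(* Descent: if N z = p c with 1 < c < p, reduce z mod c to z' and divide z times
   the conjugate of z' by c. *)
Lemma exists_norm_prime p : prime p -> (p %% 3 = 1)%N ->
  exists z, enorm z = p%:Z.
Proof.
move=> pr p3; have p1 := prime_gt1 pr.
have [r rp pr'] := exists_norm_multiple _ pr p3.
have : exists c, exists z, [/\ (0 < c)%N, (c < p)%N & enorm z = p%:Z * c%:Z].
  move/dvdzP: pr' => [c E]; exists (absz c), (r, 1).
  have E1 : enorm (r, 1) = c * p%:Z by rewrite -E /enorm /=; ring.
  have c0 : 0 < c.
    have : 0 < r ^+ 2 - r + 1 by nia.
    by rewrite E pmulr_lgt0; lia.
  have cp : c < p%:Z.
    rewrite -(ltr_pM2r (_ : 0 < p%:Z)) -?E; last by lia.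
    nia.
  by rewrite E1 mulrC; split; [lia|lia|congr (_ * _); lia].
move=> [c]; elim/ltn_ind: c => c IH [z [c0 cp E]].
have [c1|c1] := leqP c 1.
  by exists z; rewrite E (_ : c = 1%N) ?mulr1 //; lia.
case: z E => x y E.
have [q [a [Ea a4]]] := centered_residue x _ c0.
have [s [b [Eb b4]]] := centered_residue y _ c0.
have Ez : enorm (a, b) = c%:Z *
    (p%:Z - (2 * a * q - a * s - b * q + 2 * b * s) - c%:Z * (q ^+ 2 - q * s + s ^+ 2)).
  have -> : enorm (a, b) =
      enorm (x, y) - c%:Z * (2 * a * q - a * s - b * q + 2 * b * s) - c%:Z ^+ 2 * (q ^+ 2 - q * s + s ^+ 2).
    by rewrite /enorm /= Ea Eb; ring.
  by rewrite E; ring.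
move: Ez; set d := (X in _ = _ * X) => Ez.
have d0 : 0 <= d.
  by rewrite -(pmulr_rge0 _ (_ : 0 < c%:Z)) -?Ez ?enorm_ge0 //; lia.
(* Both coordinates are at most c/2 in absolute value, so the norm is at most 3 c^2 / 4. *)
have dc : d < c%:Z.
  rewrite -(ltr_pM2l (_ : 0 < c%:Z)) -?Ez; last by lia.
  have : 0 <= (a + b) ^+ 2 := sqr_ge0 _.
  have : 0 < c%:Z ^+ 2 by rewrite exprn_gt0 //; lia.
  have : (a + b) ^+ 2 = a ^+ 2 + b ^+ 2 + 2 * (a * b) by ring.
  rewrite /enorm /= -expr2; lia.
(* If d = 0, then c divides z, so c^2 divides p c and c divides p, against 1 < c < p. *)
have [d00|dn0] := eqVneq d 0.
  have /enorm_eq0[a0 b0] : enorm (a, b) = 0 by rewrite Ez d00 mulr0.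
  have pc : p%:Z = c%:Z * (q ^+ 2 - q * s + s ^+ 2).
    apply: (@mulfI _ c%:Z); first by lia.
    by rewrite mulrC -E Ea Eb a0 b0 /enorm /=; ring.
  have : (c %| p)%N.
    have : (c%:Z %| p%:Z)%Z by rewrite pc dvdz_mulr.
    by rewrite dvdzE.
  by move=> /(primeP pr).2 /orP[] /eqP; lia.
apply: (IH (absz d)); first by lia.
(* Modulo c this product is the norm of (a, b), which is c d, so c divides u. Its norm is (p c)(c
   d), hence u / c has norm p d. *)
pose u := emul (x, y) (econj (a, b)).
have [u1 [u2 Eu]] : exists u1 u2, u = (c%:Z * u1, c%:Z * u2).
  exists (d + (q * (a - b) + s * b)), (s * a - q * b).
  rewrite /u /emul /econj /= Ea Eb; congr (_, _); last by ring.
  transitivity (enorm (a, b) + c%:Z * (q * (a - b) + s * b)).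
    by rewrite /enorm /=; ring.
  by rewrite Ez; ring.
exists (u1, u2); split; [lia|lia|].
apply: (@mulfI _ (c%:Z ^+ 2)); first by rewrite expf_neq0; lia.
transitivity (enorm u); first by rewrite Eu /enorm /=; ring.
rewrite /u enormM enorm_conj E Ez (gez0_abs d0); ring.
Qed.

(** * Divisibility by an element of prime norm and the count of elements of given norm *)

Definition scale (c : int) (z : int * int) : int * int := (c * z.1, c * z.2).

Lemma emul_scale c z w : emul z (scale c w) = scale c (emul z w).
Proof. by rewrite /emul /scale /=; congr (_, _); ring. Qed.

Lemma emul_conj z w : emul (econj w) (emul w z) = scale (enorm w) z.
Proof. by rewrite /emul /econj /scale /enorm; case: z w => [a b] [c d] /=; congr (_, _); ring. Qed.

Lemma econjK z : econj (econj z) = z.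
Proof. by case: z => a b; rewrite /econj /=; congr (_, _); ring. Qed.

Definition edivz (p : nat) (z : int * int) : int * int := (z.1 %/ p, z.2 %/ p)%Z.

Lemma edivz_scale p z : (0 < p)%N -> edivz p (scale p z) = z.
Proof. by case: z => a b p0; rewrite /edivz /scale /= !mulKz //; lia. Qed.

Lemma scale_edivz p z : edvd p z -> scale p (edivz p z) = z.
Proof. by case: z => a b /andP[/= pa pb]; rewrite /scale /edivz /= ![p%:Z * _]mulrC !divzK. Qed.

Lemma edvd_scale p z : edvd p (scale p z).
Proof. by rewrite /edvd /= !dvdz_mulr. Qed.

(** p = w conj(w) divides conj(w) z exactly when w divides z, so multiplication by w is the
    bijection. *)
Lemma count_emul_conj p m w : (0 < p)%N -> enorm w = p%:Z ->
  count (fun z => edvd p (emul (econj w) z)) (eisenstein_of_norm (p * m)) = reps m.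
Proof.
move=> p0 wp; rewrite /reps -count_predT.
have wp' : enorm (econj w) = p%:Z by rewrite enorm_conj.
apply: (count_bij _ _ _ _ _ _ (fun z => edivz p (emul (econj w) z)) (emul w));
  rewrite ?eisenstein_of_norm_uniq //.
  move=> z; rewrite !mem_eisenstein_of_norm => /eqP zm pz; split=> //.
    apply/eqP/(@mulfI _ (p%:Z ^+ 2)); first by rewrite expf_neq0; lia.
    transitivity (enorm (scale p (edivz p (emul (econj w) z)))).
      by rewrite /enorm /scale /=; ring.
    by rewrite scale_edivz // enormM zm wp' PoszM; ring.
  rewrite -[LHS](edivz_scale p) // -emul_scale scale_edivz //.
  by rewrite -{1}[w]econjK emul_conj wp' edivz_scale.
move=> z; rewrite !mem_eisenstein_of_norm => /eqP zm _.
by rewrite emul_conj wp edvd_scale edivz_scale // enormM zm wp PoszM.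
Qed.

Lemma reps_inert p m : prime p -> (p %% 3 = 2)%N -> (0 < m)%N ->
  reps (p * m) = (if (p %| m)%N then reps (m %/ p) else 0)%N.
Proof.
move=> pr p3 m0; rewrite -(count_edvd _ _ (prime_gt0 pr) m0).
rewrite /reps -count_predT; apply: eq_in_count => z.
rewrite mem_eisenstein_of_norm => /eqP E.
by apply/esym/edvd_inert => //; rewrite E PoszM dvdz_mulr.
Qed.

Lemma prime_dvdzM (p : nat) (u v : int) : prime p ->
  (p %| u * v)%Z = (p %| u)%Z || (p %| v)%Z.
Proof. by move=> pr; rewrite -!Fp_int_eq0 // rmorphM /= mulf_eq0. Qed.

(** Every element of norm 3 m is divisible by 1 - w, because (x + y)^2 = 3 m + 3 x y forces 3 to
    divide x + y. *)
Lemma reps_ramified m : reps (3 * m) = reps m.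
Proof.
have w3 : enorm (1, -1) = 3%N by [].
rewrite -(count_emul_conj _ m _ _ w3) // /reps -count_predT.
apply: eq_in_count => -[x y]; rewrite mem_eisenstein_of_norm /enorm /= => /eqP E.
apply/esym/andP; rewrite /emul /econj /=.
have : (3%N%:Z %| (x + y) ^+ 2)%Z.
  rewrite (_ : (x + y) ^+ 2 = 3 * (m%:Z + x * y)) ?dvdz_mulr //.
  by rewrite mulrDr -PoszM -E; ring.
rewrite expr2 prime_dvdzM // orbb => /dvdzP[c h].
by split; apply/dvdzP; [exists (x - c)|exists c]; lia.
Qed.

(** Inclusion-exclusion: for w of norm p, each element of norm p m is divisible by w or by its
    conjugate, and divisibility by both amounts to divisibility by p. *)
Lemma reps_split p m : prime p -> (p %% 3 = 1)%N -> (0 < m)%N ->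
  (reps (p * m) + (if (p %| m)%N then reps (m %/ p) else 0) = reps m + reps m)%N.
Proof.
move=> pr p3 m0; have [[s t] wp] := exists_norm_prime _ pr p3.
have p0 := prime_gt0 pr.
rewrite -{1}(count_emul_conj _ m _ p0 wp).
rewrite -(count_emul_conj _ m (econj (s, t)) p0); last by rewrite enorm_conj.
rewrite econjK -count_predUI -count_edvd //.
have pp (u : int) : (p %| u ^+ 2)%Z -> (p %| u)%Z.
  by rewrite expr2 prime_dvdzM // orbb.
have dM (u v : int) : (p %| u * v)%Z = (p %| u)%Z || (p %| v)%Z.
  exact: prime_dvdzM.
have norm_snd z : (p %| enorm z)%Z -> (p %| z.2)%Z -> edvd p z.
  rewrite /edvd => pz p2; rewrite p2 andbT; apply: pp.
  have -> : z.1 ^+ 2 = enorm z + z.2 * (z.1 - z.2) by rewrite /enorm; ring.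
  by rewrite rpredD // dvdz_mulr.
have pt : ~~ (p %| t)%Z.
  apply/negP => pt; have /andP[/= ps _] : edvd p (s, t).
    by apply: norm_snd => //; rewrite wp.
  move/dvdzP: pt ps wp => [t' ->] /dvdzP[s' ->]; rewrite /enorm /=.
  move=> H; have : p%:Z * (p%:Z * (s' ^+ 2 - s' * t' + t' ^+ 2)) = p%:Z * 1.
    by rewrite mulr1 -[RHS]H; ring.
  move/mulfI; have pn0 : p%:Z != 0 by lia.
  move=> /(_ pn0) H'; have : (p%:Z %| 1%R)%Z by rewrite -H' dvdz_mulr.
  by rewrite dvdzE dvdn1; have := prime_gt1 pr; lia.
have p2st : ~~ (p %| 2 * s - t)%Z.
  apply: contra pt => h; have : (p %| 3 * t ^+ 2)%Z.
    have -> : 3 * t ^+ 2 = 4 * p%:Z - (2 * s - t) * (2 * s - t) by rewrite -wp /enorm /=; ring.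
    by rewrite rpredB ?dvdz_mull.
  rewrite dM => /orP[|/pp //]; rewrite dvdzE /= dvdn_prime2 // => /eqP; lia.
congr (_ + _)%N.
  rewrite /reps -count_predT; apply: eq_in_count => -[x y].
  rewrite mem_eisenstein_of_norm => /eqP E /=; apply/esym/orP.
  have pE : (p %| enorm (x, y))%Z by rewrite E PoszM dvdz_mulr.
  (* The factors are the second coordinates of conj(w) z and w z; by [norm_snd] one divisible
     coordinate suffices. *)
  have : (p %| (y * s - x * t) * (x * t + y * s - y * t))%Z.
    have -> : (y * s - x * t) * (x * t + y * s - y * t) =
        y ^+ 2 * enorm (s, t) - t ^+ 2 * enorm (x, y) by rewrite /enorm /=; ring.
    by rewrite wp rpredB ?dvdz_mull.
  rewrite dM => /orP[h|h]; [left|right]; apply: norm_snd; rewrite ?enormM ?dvdz_mull //.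
    by rewrite (_ : _.2 = y * s - x * t) // /emul /econj /=; ring.
  by rewrite (_ : _.2 = x * t + y * s - y * t) // /emul /=; ring.
apply: eq_in_count => -[x y] _ /=; apply/idP/andP => [/andP[/= px py]|].
  by rewrite /edvd /emul /econj /= !rpredD ?rpredN ?dvdz_mull ?dvdz_mulr.
rewrite /edvd /emul /econj /= => -[/andP[_ h1] /andP[_ h2]].
have py : (p %| y)%Z.
  have : (p %| y * (2 * s - t))%Z.
    rewrite (_ : y * _ = (s - t) * y + - t * x - - t * y + (s * y + t * x - t * y)).
      by rewrite rpredD.
    by ring.
  by rewrite dM (negPf p2st) orbF.
rewrite py andbT; have : (p %| t * x)%Z.
  have -> : t * x = (s * y + t * x - t * y) - y * (s - t) by ring.
  by rewrite rpredB // dvdz_mulr.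
by rewrite dM (negPf pt).
Qed.

(** Removing the least prime factor p of n, [dconv_prime] matches the three laws for [reps] at
    chi(p) = 0, 1, -1; the 6 counts the units. *)
Lemma reps_dconv n : (0 < n)%N -> (reps n)%:Z = 6 * dconv chi (fun=> 1) n.
Proof.
elim/ltn_ind: n => n IH n0; have [->|n1] := eqVneq n 1%N.
  by rewrite dconv1 /chi.
have pr : prime (pdiv n) by apply: pdiv_prime; lia.
have := pdiv_dvd n; set p := pdiv n in pr *; move/dvdnP => [m E].
have p1 := prime_gt1 pr; rewrite mulnC in E.
have m0 : (0 < m)%N by nia.
have M1 : {morph (fun=> 1 : int) : a b / (a * b)%N >-> a * b} by move=> *; rewrite mul1r.
rewrite E (dconv_prime _ _ _ _ chiM M1 pr m0).
rewrite mulr1 mulrBr [_ * (_ * dconv _ _ _)]mulrCA -IH //; last by nia.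
have -> : 6 * (chi p * (if (p %| m)%N then dconv chi (fun=> 1) (m %/ p) else 0)) =
   chi p * (if (p %| m)%N then reps (m %/ p) else 0)%N%:Z.
  rewrite mulrCA; case: ifP => [/dvdnP[k Ek]|_]; last by rewrite mulr0.
  by rewrite IH // Ek mulnK //; nia.
have [c|[c|c]] : (p %% 3 = 0 \/ p %% 3 = 1 \/ p %% 3 = 2)%N by lia.
- have -> : p = 3%N.
    by apply/eqP; rewrite eq_sym -dvdn_prime2 // /dvdn c.
  by rewrite reps_ramified /chi /=; lia.
- by have := reps_split _ _ pr c m0; rewrite /chi c /=; lia.
by rewrite reps_inert // /chi c /=; lia.
Qed.

(** * Beta sets of 3-cores *)

Local Open Scope nat_scope.

Definition is_partition (la : seq nat) := sorted geq la && all (ltn 0) la.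

Lemma geq_trans : transitive geq.
Proof. by move=> x y z; rewrite /geq /=; lia. Qed.

Local Arguments conj_part : simpl never.

Lemma conj_part_cons x l j : conj_part (x :: l) j = (j < x) + conj_part l j.
Proof. by []. Qed.

Lemma conj_part_ge x l j : path geq x l -> x <= j -> conj_part l j = 0.
Proof.
rewrite (path_sortedE geq_trans) => /andP[/allP h _] xj.
by apply/eqP; rewrite -leqn0 leqNgt -has_count; apply/hasPn => y /h /=; lia.
Qed.

Lemma conj_part_size l j : conj_part l j <= size l.
Proof. exact: count_size. Qed.

(** Deleting the first row keeps the other hooks: every column meeting a lower row also meets the
    first one, so it loses one cell just as the row index drops by one. *)
Lemma is_core_cons t x l : path geq x l ->
  is_core t (x :: l) =
  all (fun j => ~~ (t %| x - j + conj_part l j)) (iota 0 x) && is_core t l.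
Proof.
move=> xl; rewrite /is_core /=; congr (_ && _).
  apply: eq_in_all => j; rewrite mem_iota /hook conj_part_cons /= => jx.
  by congr (~~ (_ %| _)); lia.
rewrite (iotaDl 1 0) all_map; apply: eq_in_all => i; rewrite mem_iota /= => il.
apply: eq_in_all => j; rewrite mem_iota /= => jx.
rewrite /hook conj_part_cons /=; congr (~~ (_ %| _)).
have : nth 0 l i <= x.
  move: xl; rewrite (path_sortedE geq_trans) => /andP[/allP h _].
  by apply: h; rewrite mem_nth //; lia.
by move: jx; rewrite !add0n; lia.
Qed.

(* The first-column hook lengths of la, in decreasing order. *)
Fixpoint beta (la : seq nat) : seq nat :=
  if la is x :: l then (x + size l) :: beta l else [::].

Fixpoint unbeta (b : seq nat) : seq nat :=
  if b is x :: l then (x - size l) :: unbeta l else [::].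

Lemma size_beta la : size (beta la) = size la.
Proof. by elim: la => //= x l ->. Qed.

Lemma size_unbeta b : size (unbeta b) = size b.
Proof. by elim: b => //= x l ->. Qed.

Lemma betaK : cancel beta unbeta.
Proof. by elim=> //= x l ->; rewrite size_beta addnK. Qed.

Lemma sumn_beta la : 2 * sumn (beta la) + size la = 2 * sumn la + size la ^ 2.
Proof. by elim: la => //= x l; lia. Qed.

Lemma beta_sorted la : sorted geq la -> sorted gtn (beta la).
Proof.
case: la => // x l; elim: l x => //= y l IH x /andP[xy yl].
by rewrite IH // andbT; move: xy; rewrite /geq /=; lia.
Qed.

(* The complement of the beta set is read off the columns of the diagram. *)
Lemma notin_beta l s : sorted geq l ->
  (s \notin beta l) <-> exists j, s + conj_part l j = size l + j.
Proof.
elim: l s => [|x l IH] s /= xl; first by split=> // _; exists s; rewrite addn0.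
have sl : sorted geq l := path_sorted xl.
rewrite inE negb_or; split=> [/andP[sx /IH[]// j E]|[j]].
  have [jx|xj] := ltnP j x; first by exists j; rewrite conj_part_cons jx; lia.
  move: E; rewrite (conj_part_ge _ _ _ xl xj) => E.
  by exists j.-1; rewrite conj_part_cons (conj_part_ge _ _ _ xl); lia.
rewrite conj_part_cons; have [jx|xj] := ltnP j x => E.
  by apply/andP; split; [lia|apply/IH => //; exists j; lia].
move: E; rewrite (conj_part_ge _ _ _ xl xj) => E; apply/andP; split; first lia.
by apply/IH => //; exists j.+1; rewrite (conj_part_ge _ _ _ xl); lia.
Qed.

(** The hook lengths of the first row are the differences between the largest beta number and the
    smaller numbers missing from the beta set; the lower rows follow by induction. *)
Lemma is_coreP t la : sorted geq la ->
  is_core t la <->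
  (forall b s, b \in beta la -> s < b -> t %| b - s -> s \in beta la).
Proof.
elim: la => [|x l IH] xl; first by split.
have sl : sorted geq l := path_sorted xl.
have xb b : b \in beta l -> b < x + size l.
  have := beta_sorted _ xl => /= /(order_path_min _)/allP; apply.
  by move=> ? ? ?; rewrite /gtn /=; lia.
rewrite is_core_cons //; split=> [/andP[/allP h /(IH sl) c] b s|h].
  rewrite /= !inE => /orP[/eqP ->|bl] sb tb; last by rewrite (c b) ?orbT.
  apply/orP; right; apply/negPn/negP => /(notin_beta _ _ sl)[j E].
  have jx : j < x.
    by rewrite ltnNge; apply/negP => xj; move: E; rewrite (conj_part_ge _ _ _ xl xj); lia.
  have /h : j \in iota 0 x by rewrite mem_iota.
  by rewrite (_ : x - j + conj_part l j = x + size l - s) ?tb //; lia.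
apply/andP; split.
  apply/allP => j; rewrite mem_iota => /= jx; apply/negP => tj.
  have cs := conj_part_size l j.
  have : size l + j - conj_part l j \notin beta l.
    by apply/notin_beta => //; exists j; lia.
  have := h (x + size l) (size l + j - conj_part l j); rewrite /= !inE eqxx.
  rewrite (_ : x + size l - _ = x - j + conj_part l j); last lia.
  have sx : size l + j - conj_part l j < x + size l by lia.
  by move=> /(_ isT sx tj) /orP[/eqP|->//]; lia.
apply/(IH sl) => b s bl sb tb; have := h b s; rewrite /= !inE bl orbT sb tb.
by move=> /(_ isT isT isT) /orP[/eqP E|//]; have := xb _ bl; lia.
Qed.

Lemma beta_gt0 la : all (ltn 0) la -> all (ltn 0) (beta la).
Proof. by elim: la => //= x l IH /andP[x0 /IH ->]; rewrite andbT; lia. Qed.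

(** Fewer than b positive numbers lie below b; this keeps the truncated subtraction in [unbeta]
    exact. *)
Lemma gtn_size b s : path gtn b s -> all (ltn 0) (b :: s) -> size s < b.
Proof.
by elim: s b => [|c s IH] b /=; [rewrite andbT | move=> /andP[bc cs] /andP[_ h]; have := IH c cs h; lia].
Qed.

Lemma unbetaK b : sorted gtn b -> all (ltn 0) b -> beta (unbeta b) = b.
Proof.
elim: b => //= x l IH xl /andP[x0 l0]; rewrite IH ?(path_sorted xl) // size_unbeta subnK //.
by apply: ltnW; apply: gtn_size; rewrite /= ?x0.
Qed.

Lemma unbeta_partition b : sorted gtn b -> all (ltn 0) b -> is_partition (unbeta b).
Proof.
rewrite /is_partition; case: b => // x l; elim: l x => [|y l IH] x.
  by rewrite /= !subn0.
move=> xyl xyl0; have := gtn_size _ _ xyl xyl0.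
move: xyl xyl0 => /= /andP[xy yl] /and3P[x0 y0 l0] xs.
have := IH y yl; rewrite /= y0 l0 => /(_ isT) /andP[-> ->]; rewrite !andbT.
have := gtn_size y l yl; rewrite /= y0 l0 => /(_ isT) ys.
by apply/andP; split; [rewrite /geq /=|]; lia.
Qed.

Lemma downclosed_mem (D : seq nat) : uniq D ->
  (forall k j, k \in D -> j < k -> j \in D) -> forall k, (k \in D) = (k < size D).
Proof.
move=> uD dD k; apply/idP/idP => [kD|].
  rewrite -[k.+1](size_iota 0); apply: uniq_leq_size (iota_uniq _ _) _ => j.
  rewrite mem_iota /= add0n ltnS leq_eqVlt => /orP[/eqP ->//|jk].
  exact: dD kD jk.
apply: contraLR => kD; rewrite -leqNgt -[k](size_iota 0).
apply: uniq_leq_size uD _ => j jD; rewrite mem_iota add0n /= ltnNge.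
apply/negP; rewrite leq_eqVlt => /orP[/eqP E|kj]; last by rewrite (dD j) in kD.
by rewrite E jD in kD.
Qed.

Definition on_runners (u v s : nat) : bool :=
  (s %% 3 == 1) && (s %/ 3 < u) || (s %% 3 == 2) && (s %/ 3 < v).

(* All parts being positive, 0 is not in the beta set, so only the runners 1 and 2
   are occupied. *)
Lemma core_beta_mem la : is_partition la -> is_core 3 la ->
  forall s, (s \in beta la) =
    on_runners (count (fun x => x %% 3 == 1) (beta la))
               (count (fun x => x %% 3 == 2) (beta la)) s.
Proof.
move=> /andP[sl l0] /(is_coreP _ _ sl) cl.
have uB : uniq (beta la).
  by have := beta_sorted _ sl; rewrite gtn_sorted_uniq_geq => /andP[].
have H r s : r < 3 -> s %% 3 = r ->
    (s \in beta la) = (s %/ 3 < count (fun x => x %% 3 == r) (beta la)).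
  move=> r3 sr.
  (* These are the positions occupied on runner r; the core property closes them downwards, so they
     form an initial segment. *)
  have mD k : (k \in [seq x %/ 3 | x <- beta la & x %% 3 == r]) = (3 * k + r \in beta la).
    apply/mapP/idP => [[x]|h].
      by rewrite mem_filter => /andP[/eqP xr xB] ->; rewrite (_ : _ + _ = x) //; lia.
    by exists (3 * k + r); rewrite ?mem_filter ?h ?andbT; lia.
  rewrite -size_filter -(size_map (fun x => x %/ 3)) -downclosed_mem.
  - by rewrite mD (_ : 3 * _ + r = s) //; lia.
  - rewrite map_inj_in_uniq ?filter_uniq // => x y.
    by rewrite !mem_filter; lia.
  move=> k j; rewrite !mD => kB jk; apply: (cl _ _ kB); first lia.
  by rewrite (_ : _ - _ = 3 * (k - j)) ?dvdn_mulr //; lia.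
move=> s; rewrite /on_runners; have [c|[c|c]] : s %% 3 = 0 \/ s %% 3 = 1 \/ s %% 3 = 2 by lia.
- rewrite c /=; apply/negP => sB.
  have z : 0 \notin beta la by apply/negP => /(allP (beta_gt0 _ l0)).
  case: s c sB => [|s] c sB; first by rewrite sB in z.
  by move/negP: z; apply; apply: (cl _ _ sB) => //; rewrite subn0 /dvdn c.
- by rewrite (H 1) // c orbF.
by rewrite (H 2) // c.
Qed.

Definition runners (u v : nat) : seq nat :=
  [seq 3 * i + 1 | i <- iota 0 u] ++ [seq 3 * i + 2 | i <- iota 0 v].

Lemma mem_runners u v s : (s \in runners u v) = on_runners u v s.
Proof.
rewrite mem_cat /on_runners; congr (_ || _); apply/mapP/idP => [[i]|h].
- by rewrite mem_iota => h ->; lia.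
- by exists (s %/ 3); rewrite ?mem_iota; lia.
- by rewrite mem_iota => h ->; lia.
by exists (s %/ 3); rewrite ?mem_iota; lia.
Qed.

Lemma runners_uniq u v : uniq (runners u v).
Proof.
rewrite cat_uniq !map_inj_uniq ?iota_uniq /= ?andbT; try by move=> i j; lia.
by apply/hasPn => x /mapP[i _ ->]; apply/negP => /mapP[j _]; lia.
Qed.

Lemma size_runners u v : size (runners u v) = u + v.
Proof. by rewrite size_cat !size_map !size_iota. Qed.

Lemma sumn_runners u v : 2 * sumn (runners u v) + u = 3 * u ^ 2 + 3 * v ^ 2 + v.
Proof.
have S c n : 2 * sumn [seq 3 * i + c | i <- iota 0 n] + 3 * n = 3 * n ^ 2 + 2 * c * n.
  elim: n => [|n IH]; first by rewrite !muln0.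
  move: IH; rewrite -[n.+1]addn1 iotaD map_cat sumn_cat /= addn0 add0n; lia.
by rewrite sumn_cat mulnDr; have := S 1 u; have := S 2 v; lia.
Qed.

Definition core_of (u v : nat) : seq nat := unbeta (sort geq (runners u v)).

Lemma sort_runners u v :
  sorted gtn (sort geq (runners u v)) && all (ltn 0) (sort geq (runners u v)).
Proof.
rewrite gtn_sorted_uniq_geq sort_uniq runners_uniq sort_sorted /=.
  by rewrite all_sort; apply/allP => x; rewrite mem_runners /on_runners /=; lia.
by move=> x y; rewrite /geq /=; lia.
Qed.

Lemma beta_core_of u v : beta (core_of u v) = sort geq (runners u v).
Proof. by have /andP[s a] := sort_runners u v; rewrite unbetaK. Qed.

Lemma core_of_partition u v : is_partition (core_of u v).
Proof. by have /andP[s a] := sort_runners u v; apply: unbeta_partition. Qed.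

Lemma core_of_core u v : is_core 3 (core_of u v).
Proof.
have /andP[sl _] := core_of_partition u v.
apply/is_coreP => // b s; rewrite beta_core_of !mem_sort !mem_runners /on_runners.
by move=> h sb /dvdnP[k]; lia.
Qed.

Lemma size_core_of u v : size (core_of u v) = u + v.
Proof. by rewrite size_unbeta size_sort size_runners. Qed.

(** The size is the sum of the beta set minus 0 + 1 + ... + (u + v - 1); the product stands on the
    left to avoid subtraction in [nat]. *)
Lemma sumn_core_of u v : sumn (core_of u v) + u * v = u ^ 2 + v ^ 2 + v.
Proof.
have := sumn_beta (core_of u v); rewrite beta_core_of size_core_of.
rewrite (perm_sumn (permEl (perm_sort geq (runners u v)))).
by have := sumn_runners u v; nia.
Qed.

Lemma count_core_of u v :
  count (fun x => x %% 3 == 1) (beta (core_of u v)) = u /\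
  count (fun x => x %% 3 == 2) (beta (core_of u v)) = v.
Proof.
rewrite beta_core_of !count_sort !count_cat !count_map; split.
  rewrite (@eq_count _ _ predT) => [|i /=]; last by lia.
  rewrite [X in _ + X](@eq_count _ _ pred0) => [|i /=]; last by lia.
  by rewrite count_predT count_pred0 size_iota addn0.
rewrite (@eq_count _ _ pred0) => [|i /=]; last by lia.
rewrite [X in _ + X](@eq_count _ _ predT) => [|i /=]; last by lia.
by rewrite count_predT count_pred0 size_iota.
Qed.

Lemma core_of_count la : is_partition la -> is_core 3 la ->
  core_of (count (fun x => x %% 3 == 1) (beta la))
          (count (fun x => x %% 3 == 2) (beta la)) = la.
Proof.
move=> pl cl; rewrite -[RHS]betaK; congr unbeta.
have /andP[sl _] := pl; have := beta_sorted _ sl.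
rewrite gtn_sorted_uniq_geq => /andP[uB sB].
apply: (sorted_eq geq_trans) => //.
- by move=> x y; rewrite /geq /=; lia.
- by apply: sort_sorted => x y; rewrite /geq /=; lia.
rewrite perm_sort; apply: uniq_perm; rewrite ?runners_uniq // => s.
by rewrite mem_runners core_beta_mem.
Qed.

(** * Counting 3-cores *)

Lemma sorted_geq_zeros l : sorted geq l ->
  l = filter (ltn 0) l ++ nseq (size l - size (filter (ltn 0) l)) 0.
Proof.
elim: l => // -[|x] l IH /=; last first.
  by move/path_sorted/IH => {1}->; rewrite subSS.
rewrite (path_sortedE geq_trans) => /andP[/allP h _].
have -> : filter (ltn 0) l = [::].
  apply/eqP; rewrite -size_eq0 size_filter -leqn0 leqNgt -has_count.
  by apply/hasPn => y /h /=; lia.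
by rewrite /=; congr cons; apply/all_pred1P/allP => y /h /=; lia.
Qed.

Lemma sumn_filter_gt0 l : sumn (filter (ltn 0) l) = sumn l.
Proof. by elim: l => // -[|x] l /= ->. Qed.

Lemma size_le_sumn l : all (ltn 0) l -> size l <= sumn l.
Proof. by elim: l => //= x l IH /andP[x0 /IH]; lia. Qed.

Lemma nth_le_sumn l i : nth 0 l i <= sumn l.
Proof. by elim: l i => [|x l IH] [|i] //=; [lia|have := IH i; lia]. Qed.

Definition fvalues {m : nat} (f : {ffun 'I_m -> 'I_m.+1}) : seq nat :=
  [seq (f i : nat) | i <- enum 'I_m].

Lemma nth_fvalues {m} (f : {ffun 'I_m -> 'I_m.+1}) (i : 'I_m) :
  nth 0 (fvalues f) i = f i.
Proof. by rewrite (nth_map i) ?size_enum_ord // nth_ord_enum. Qed.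

Lemma size_fvalues m (f : {ffun 'I_m -> 'I_m.+1}) : size (fvalues f) = m.
Proof. by rewrite size_map size_enum_ord. Qed.

Lemma sumn_fvalues m (f : {ffun 'I_m -> 'I_m.+1}) : sumn (fvalues f) = \sum_(i < m) f i.
Proof. by rewrite sumnE big_map big_enum. Qed.

Lemma is_fpartE m (f : {ffun 'I_m -> 'I_m.+1}) :
  is_fpart f = sorted geq (fvalues f) && (sumn (fvalues f) == m).
Proof.
rewrite /is_fpart sumn_fvalues; congr (_ && _).
apply/forallP/idP => [h|s i].
  apply/(sortedP 0) => i; rewrite size_fvalues => im.
  have := h (Ordinal (ltnW im)) => /forallP/(_ (Ordinal im)); rewrite /= leqnSn /=.
  by rewrite -(nth_fvalues f (Ordinal (ltnW im))) -(nth_fvalues f (Ordinal im)).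
apply/forallP => j; apply/implyP => ij; rewrite -!nth_fvalues.
move: ij; rewrite leq_eqVlt => /orP[/eqP -> //|ij].
by apply: (sorted_ltn_nth geq_trans 0 s) => //; rewrite inE size_fvalues.
Qed.

Lemma fpart_seq_partition m (f : {ffun 'I_m -> 'I_m.+1}) : is_fpart f ->
  is_partition (fpart_seq f) /\ sumn (fpart_seq f) = m.
Proof.
rewrite is_fpartE => /andP[s /eqP E]; split; last by rewrite sumn_filter_gt0.
by rewrite /is_partition sorted_filter ?filter_all //; apply: geq_trans.
Qed.

(** The default 0 of [nth] supplies the padding, and [inord] is faithful when la sums to m because
    no part exceeds the sum. *)
Definition ffun_of_seq (m : nat) (la : seq nat) : {ffun 'I_m -> 'I_m.+1} :=
  [ffun i : 'I_m => inord (nth 0 la i)].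

Lemma ffun_of_fpart_seq m (f : {ffun 'I_m -> 'I_m.+1}) : is_fpart f ->
  ffun_of_seq m (fpart_seq f) = f.
Proof.
move=> pf; have [_ E] := fpart_seq_partition _ _ pf; move: pf.
rewrite is_fpartE => /andP[s _]; apply/ffunP => i; rewrite ffunE.
apply: val_inj; rewrite /= -[RHS]nth_fvalues (sorted_geq_zeros _ s) nth_cat.
rewrite -/(fpart_seq f); case: ltnP => h.
  rewrite inordK // ltnS; by have := nth_le_sumn (fpart_seq f) i; rewrite E.
by rewrite nth_nseq if_same nth_default // inordK.
Qed.

Lemma fvalues_of_seq m la : is_partition la -> sumn la = m ->
  fvalues (ffun_of_seq m la) = la ++ nseq (m - size la) 0.
Proof.
move=> /andP[s a] E; have sz := size_le_sumn _ a.
apply: (@eq_from_nth _ 0); first by rewrite size_fvalues size_cat size_nseq; lia.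
move=> i; rewrite size_fvalues => im.
rewrite (nth_fvalues _ (Ordinal im)) ffunE /= inordK; last first.
  by rewrite ltnS -E nth_le_sumn.
rewrite nth_cat; case: ltnP => // h.
by rewrite nth_nseq if_same nth_default.
Qed.

Lemma fpart_seq_of_seq m la : is_partition la -> sumn la = m ->
  fpart_seq (ffun_of_seq m la) = la.
Proof.
move=> p E; rewrite /fpart_seq -/(fvalues _) fvalues_of_seq // filter_cat.
have /andP[_ /all_filterP ->] := p.
by rewrite filter_nseq /= cats0.
Qed.

Lemma is_fpart_of_seq m la : is_partition la -> sumn la = m ->
  is_fpart (ffun_of_seq m la).
Proof.
move=> p E; rewrite is_fpartE fvalues_of_seq // sumn_cat sumn_nseq mul0n addn0 E eqxx andbT.
have /andP[s _] := p; case: la s {p E} => [|x l] /= s.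
  by case: (m - 0) => //= n; elim: n => //=.
rewrite cat_path s /=; elim: (m - _) (last x l) => //= n IH z.
Qed.

Local Open Scope ring_scope.

(** A core with runner lengths u, v goes to z with z.1 + z.2 = 3u + 1 and 2 z.2 - z.1 = 3v + 2. The
    residue of the second form follows from that of the first, and positivity of both says that u
    and v are natural numbers. *)
Definition core_sector (z : int * int) : bool :=
  [&& ((z.1 + z.2) %% 3 == 1)%Z, 0 < z.1 + z.2 & 0 < 2 * z.2 - z.1].

(** The three summands ask which of P, Q and 0 is the largest. *)
Lemma three_sectors (P Q : int) : P != 0 -> Q != 0 -> P != Q ->
  (((0 < P)%R && (0 < P - Q)%R) + ((0 < Q - P)%R && (0 < Q)%R) +
   ((0 < - Q)%R && (0 < - P)%R) = 1)%N.
Proof.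
rewrite !subr_gt0 !oppr_gt0.
case: (ltgtP P 0) => // hP _; case: (ltgtP Q 0) => // hQ _;
  case: (ltgtP P Q) => //= hPQ _; lia.
Qed.

(* Exactly one of the six associates of an Eisenstein integer of norm prime to 3
   lies in the sector. *)
Lemma core_sector_rot (x y : int) : ((x + y) %% 3)%Z != 0 ->
  (core_sector (x, y) + core_sector ((x - y)%R, x) + core_sector ((- y)%R, (x - y)%R) +
   core_sector ((- x)%R, (- y)%R) + core_sector ((y - x)%R, (- x)%R) +
   core_sector (y, (y - x)%R) = 1)%N.
Proof.
rewrite /core_sector /=.
have [P EP] : exists P, P = x + y by exists (x + y).
have [Q EQ] : exists Q, Q = 2 * x - y by exists (2 * x - y).
rewrite -EP (_ : 2 * y - x = P - Q); last by rewrite EP EQ; ring.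
rewrite (_ : x - y + x = Q); last by rewrite EQ; ring.
rewrite (_ : 2 * x - (x - y) = P); last by rewrite EP; ring.
rewrite (_ : - y + (x - y) = Q - P); last by rewrite EP EQ; ring.
rewrite (_ : 2 * (x - y) - - y = Q); last by rewrite EQ; ring.
rewrite (_ : - x - y = - P); last by rewrite EP; ring.
rewrite (_ : 2 * - y - - x = Q - P); last by rewrite EP EQ; ring.
rewrite (_ : y - x - x = - Q); last by rewrite EQ; ring.
rewrite (_ : 2 * - x - (y - x) = - P); last by rewrite EP; ring.
rewrite (_ : y + (y - x) = P - Q); last by rewrite EP EQ; ring.
rewrite (_ : 2 * (y - x) - y = - Q); last by rewrite EQ; ring.
(* Q = -P mod 3, so the residue test keeps every other associate, and the signs of the three kept
   are those of [three_sectors]. *)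
have {EP EQ x y} [t EQ] : exists t, Q = 3 * t - P by exists x; rewrite EP EQ; ring.
move=> P3.
have Q0 : Q != 0 by lia.
have P0 : P != 0 by lia.
have PQ : P != Q by lia.
have [r|r] : (P %% 3)%Z = 1 \/ (P %% 3)%Z = 2 by lia.
  have -> : (P %% 3 == 1)%Z by lia.
  have -> : (Q %% 3 == 1)%Z = false by lia.
  have -> : ((Q - P) %% 3 == 1)%Z by lia.
  have -> : (- P %% 3 == 1)%Z = false by lia.
  have -> : (- Q %% 3 == 1)%Z by lia.
  have -> : ((P - Q) %% 3 == 1)%Z = false by lia.
  by rewrite /= !addn0 three_sectors.
have -> : (P %% 3 == 1)%Z = false by lia.
have -> : (Q %% 3 == 1)%Z by lia.
have -> : ((Q - P) %% 3 == 1)%Z = false by lia.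
have -> : (- P %% 3 == 1)%Z by lia.
have -> : (- Q %% 3 == 1)%Z = false by lia.
have -> : ((P - Q) %% 3 == 1)%Z by lia.
rewrite /= !add0n addn0.
have := three_sectors (- P) (- Q); rewrite !oppr_eq0 eqr_opp !opprK => /(_ P0 Q0 PQ).
by rewrite [- P + Q]addrC [- Q + P]addrC => <-; rewrite [RHS]addnC addn0 addnA.
Qed.

(* u^2 - u v + v^2 + v = m iff r^2 - r s + s^2 = 3 m + 1 for r = 2 u - v and
   s = u + v + 1. *)
Lemma c3_count m : c3 m = count core_sector (eisenstein_of_norm (3 * m + 1)).
Proof.
rewrite /c3 cardE -count_predT.
pose cnt r la := count (fun x => x %% 3 == r)%N (beta la).
apply: (count_bij _ _ _ _ _ _
  (fun f => (2 * (cnt 1%N (fpart_seq f))%:Z - (cnt 2%N (fpart_seq f))%:Z,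
             (cnt 1%N (fpart_seq f))%:Z + (cnt 2%N (fpart_seq f))%:Z + 1))
  (fun z => ffun_of_seq m
     (core_of (absz ((z.1 + z.2) %/ 3)%Z) (absz ((2 * z.2 - z.1) %/ 3)%Z))));
  rewrite ?enum_uniq ?eisenstein_of_norm_uniq //.
  move=> f; rewrite mem_enum inE => /andP[pf cf] _.
  have [pl sl] := fpart_seq_partition _ _ pf.
  have Ec := core_of_count _ pl cf.
  have := sumn_core_of (cnt 1%N (fpart_seq f)) (cnt 2%N (fpart_seq f)).
  rewrite [core_of _ _]Ec sl; move: Ec; rewrite -/(cnt 1%N _) -/(cnt 2%N _).
  move: (cnt 1%N _) (cnt 2%N _) => u v Ec E; split.
  - rewrite mem_eisenstein_of_norm /enorm /=; apply/eqP; nia.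
  - rewrite /core_sector /=; lia.
  rewrite /= (_ : absz _ = u); last lia.
  by rewrite (_ : absz _ = v) ?Ec ?ffun_of_fpart_seq //; lia.
case=> r s; rewrite mem_eisenstein_of_norm /core_sector /enorm /= => /eqP E /and3P[h1 h2 h3].
have [u Eu] : exists u : nat, r + s = 3 * u%:Z + 1.
  by exists (absz ((r + s) %/ 3)%Z); lia.
have [v Ev] : exists v : nat, 2 * s - r = 3 * v%:Z + 2.
  by exists (absz ((2 * s - r) %/ 3)%Z); lia.
have -> : absz ((r + s) %/ 3)%Z = u by lia.
have -> : absz ((2 * s - r) %/ 3)%Z = v by lia.
have sm : sumn (core_of u v) = m.
  have := sumn_core_of u v.
  have Er : r = 2 * u%:Z - v%:Z by lia.
  have Es : s = u%:Z + v%:Z + 1 by lia.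
  by move: E; rewrite Er Es; nia.
have pc := core_of_partition u v.
rewrite mem_enum inE is_fpart_of_seq // fpart_seq_of_seq // core_of_core.
split=> //; have [c1 c2] := count_core_of u v.
by rewrite /cnt c1 c2; congr (_, _); lia.
Qed.

Lemma c3_chi_sigma m : (c3 m)%:Z = chi_sigma m.
Proof.
have n0 : (0 < 3 * m + 1)%N by lia.
(* Multiplication by 1 + w, a unit of order 6: its iterates run through the associates and permute
   the elements of given norm. *)
pose rot (z : int * int) := (z.1 - z.2, z.1).
have rotN z : enorm (rot z) = enorm z by rewrite /enorm /rot /=; ring.
have cr P : count P (eisenstein_of_norm (3 * m + 1)) =
    count (P \o rot) (eisenstein_of_norm (3 * m + 1)).
  apply/esym/(count_bij _ _ _ _ _ _ rot (fun z => (z.2, z.2 - z.1)));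
    rewrite ?eisenstein_of_norm_uniq //.
    move=> [x y]; rewrite !mem_eisenstein_of_norm rotN /rot => -> h; split=> //=.
    by congr (_, _); ring.
  move=> [x y]; rewrite !mem_eisenstein_of_norm /= -(rotN (y, y - x)) /rot /=.
  by rewrite (_ : y - (y - x) = x); [|ring].
have E6 : (6 * c3 m = reps (3 * m + 1))%N.
  rewrite c3_count; set L := eisenstein_of_norm _ in cr *.
  have step f g : (forall z, f (rot z) = g z) ->
      count (fun z => core_sector (f z)) L = count (fun z => core_sector (g z)) L.
    by move=> fg; rewrite [LHS]cr; apply: eq_count => z; rewrite /= -fg.
  have c1 : count core_sector L = count (fun z => core_sector (z.1 - z.2, z.1)) L.
    by apply: (step id).
  have c2 := step (fun z => (z.1 - z.2, z.1)) (fun z => (- z.2, z.1 - z.2)).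
  have c3' := step (fun z => (- z.2, z.1 - z.2)) (fun z => (- z.1, - z.2)).
  have c4 := step (fun z => (- z.1, - z.2)) (fun z => (z.2 - z.1, - z.1)).
  have c5 := step (fun z => (z.2 - z.1, - z.1)) (fun z => (z.2, z.2 - z.1)).
  have cnt P : count P L = (\sum_(z <- L) P z)%N.
    by rewrite -sum1_count big_mkcond; apply: eq_bigr => z _; case: (P z).
  transitivity (\sum_(z <- L) (core_sector z + core_sector ((z.1 - z.2)%R, z.1) +
      core_sector ((- z.2)%R, (z.1 - z.2)%R) + core_sector ((- z.1)%R, (- z.2)%R) +
      core_sector ((z.2 - z.1)%R, (- z.1)%R) + core_sector (z.2, (z.2 - z.1)%R)))%N.
    rewrite !big_split /= -!cnt -c5; last by move=> z; rewrite /rot /=; congr (_, _); ring.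
    rewrite -c4; last by move=> z; rewrite /rot /=; congr (_, _); ring.
    rewrite -c3'; last by move=> z; rewrite /rot /=; congr (_, _); ring.
    rewrite -c2; last by move=> z; rewrite /rot /=; congr (_, _); ring.
    by rewrite -c1 !mulSn mul0n addn0 !addnA.
  rewrite /reps -/L -sum1_size [LHS]big_seq [RHS]big_seq; apply: eq_bigr => -[x y].
  rewrite mem_eisenstein_of_norm => /eqP E; apply: core_sector_rot.
  (* (x + y)^2 - 3 x y is the norm 3 m + 1, so 3 cannot divide x + y. *)
  apply/eqP => /dvdz_mod0P h; have : (3 %| (x + y) * (x + y) - 3 * (x * y))%Z.
    by rewrite rpredB // dvdz_mulr.
  have -> : (x + y) * (x + y) - 3 * (x * y) = (3 * m + 1)%N%:Z.
    by rewrite -E /enorm /=; ring.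
  lia.
have -> : (c3 m)%:Z = dconv chi (fun=> 1) (3 * m + 1).
  by have := reps_dconv _ n0; lia.
by rewrite /dconv /chi_sigma; apply: eq_bigr => *; rewrite mulr1.
Qed.

Lemma B3_eisenstein3 n : (B3 n)%:Z = eisenstein3 n.+1.
Proof.
rewrite -conv_chi_sigma3 /B3 -natz natr_sum; apply: eq_bigr => a _; rewrite natr_sum.
(* Given a, only b <= n - a leaves room for a third size, which is then forced to be n - a - b. *)
rewrite big_distrr /= (bigID (fun b : 'I_n.+1 => b < (n - a).+1)%N) /=.
rewrite [X in _ + X]big1 ?addr0 => [|b]; last first.
  by move=> h; rewrite big1 // => c _; rewrite ifF //; have := ltn_ord a; lia.
rewrite (big_ord_widen n.+1 (fun b => chi_sigma a * (chi_sigma b * chi_sigma (n - a - b)%N))); last by lia.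
apply: eq_bigr => b ba; rewrite natr_sum.
have ha := ltn_ord a.
have cn : (n - a - b < n.+1)%N by lia.
rewrite (bigD1 (Ordinal cn)) //= ifT; last by lia.
rewrite big1 ?addr0 => [|c /eqP cne].
  by rewrite !natrM -!c3_chi_sigma !natz mulrA.
rewrite ifF //; apply/negP => /eqP H; apply: cne; apply: val_inj => /=; lia.
Qed.

(** * The recurrence along powers of a prime *)

Lemma eisenstein3_prime p m : prime p -> (0 < m)%N ->
  eisenstein3 (p * (p * m)) =
    (chi p + (p ^ 2)%N%:Z) * eisenstein3 (p * m) - chi p * (p ^ 2)%N%:Z * eisenstein3 m.
Proof.
move=> pr m0; have sqM : {morph (fun d => (d ^ 2)%N%:Z) : a b / (a * b)%N >-> a * b}.
  by move=> a b; rewrite expnMn PoszM.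
have p0 := prime_gt0 pr.
by rewrite {1}/eisenstein3 (dconv_prime _ _ _ _ chiM sqM pr) ?muln_gt0 ?p0 // dvdn_mulr // mulKn.
Qed.

(** The closed form of a second-order recurrence with characteristic roots p^2 and chi(p),
    multiplied by their difference so as to stay in [int]. *)
Lemma eisenstein3_pow p k m : prime p -> (p %% 3 != 0)%N -> (0 < m)%N ->
  ((p ^ 2)%N%:Z - chi p) * eisenstein3 (p ^ k * m) =
    ((p ^ (2 * k))%N%:Z - chi p ^+ k) * eisenstein3 (p * m)
    - (chi p * (p ^ (2 * k))%N%:Z - chi p ^+ k * (p ^ 2)%N%:Z) * eisenstein3 m.
Proof.
move=> pr p3 m0.
have c2 : chi p = 1 \/ chi p = -1.
  by rewrite /chi; case: ifP => c1; [left|right; rewrite ifT //; lia].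
have T j : (p ^ (2 * j.+1))%N%:Z = (p ^ 2)%N%:Z * (p ^ (2 * j))%N%:Z.
  by rewrite -PoszM -expnD mulnS.
suff : ((p ^ 2)%N%:Z - chi p) * eisenstein3 (p ^ k * m) =
    ((p ^ (2 * k))%N%:Z - chi p ^+ k) * eisenstein3 (p * m)
    - (chi p * (p ^ (2 * k))%N%:Z - chi p ^+ k * (p ^ 2)%N%:Z) * eisenstein3 m /\
  ((p ^ 2)%N%:Z - chi p) * eisenstein3 (p ^ k.+1 * m) =
    ((p ^ (2 * k.+1))%N%:Z - chi p ^+ k.+1) * eisenstein3 (p * m)
    - (chi p * (p ^ (2 * k.+1))%N%:Z - chi p ^+ k.+1 * (p ^ 2)%N%:Z) * eisenstein3 m by case.
elim: k => [|k [IH1 IH2]].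
  by rewrite muln0 !expn0 mul1n muln1 expn1 expr0 expr1; split; ring.
split=> //; have -> : (p ^ k.+2 * m = p * (p * (p ^ k * m)))%N by rewrite !expnS; lia.
rewrite eisenstein3_prime ?muln_gt0 ?expn_gt0 ?m0 ?(prime_gt0 pr) //.
have -> : (p * (p ^ k * m) = p ^ k.+1 * m)%N by rewrite expnS; lia.
transitivity ((chi p + (p ^ 2)%N%:Z) * (((p ^ 2)%N%:Z - chi p) * eisenstein3 (p ^ k.+1 * m))
  - chi p * (p ^ 2)%N%:Z * (((p ^ 2)%N%:Z - chi p) * eisenstein3 (p ^ k * m))); first by ring.
rewrite IH1 IH2 !T !exprS; case: c2 => ->; ring.
Qed.

Theorem theorem3p3 (p k n : nat) (hp : prime p) :
  ((p %% 3 = 1)%N ->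
    (B3 (p ^ k * n + p ^ k - 1))%:R =
      ((p ^ (2 * k))%:R - 1) / ((p ^ 2)%:R - 1) * (B3 (p * n + p - 1))%:R
      - ((p ^ (2 * k))%:R - (p ^ 2)%:R) / ((p ^ 2)%:R - 1) * (B3 n)%:R :> rat)
  /\
  ((p %% 3 = 2)%N ->
    (B3 (p ^ k * n + p ^ k - 1))%:R =
      ((p ^ (2 * k))%:R - (-1) ^+ k) / ((p ^ 2)%:R + 1) * (B3 (p * n + p - 1))%:R
      + ((p ^ (2 * k))%:R + (-1) ^+ k * (p ^ 2)%:R) / ((p ^ 2)%:R + 1) * (B3 n)%:R :> rat).
Proof.
have p1 := prime_gt1 hp.
have pk : (0 < p ^ k)%N by rewrite expn_gt0 prime_gt0.
have E1 : ((p ^ k * n + p ^ k - 1).+1 = p ^ k * n.+1)%N by rewrite mulnS; lia.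
have E2 : ((p * n + p - 1).+1 = p * n.+1)%N by rewrite mulnS; lia.
have B (i : nat) : (B3 i)%:R = (eisenstein3 i.+1)%:~R :> rat by rewrite -B3_eisenstein3.
have P : (p %% 3 != 0)%N ->
  ((p ^ 2)%:R - (chi p)%:~R) * (B3 (p ^ k * n + p ^ k - 1))%:R =
    ((p ^ (2 * k))%:R - (chi p)%:~R ^+ k) * (B3 (p * n + p - 1))%:R
    - ((chi p)%:~R * (p ^ (2 * k))%:R - (chi p)%:~R ^+ k * (p ^ 2)%:R) * (B3 n)%:R :> rat.
  move=> p3; rewrite !B E1 E2.
  have := congr1 (intr : int -> rat) (eisenstein3_pow p k n.+1 hp p3 isT).
  by rewrite !(rmorphB, rmorphM, rmorphXn).
have p2 : 1 < (p ^ 2)%:R :> rat by rewrite ltr1n; nia.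
(* The unsimplified factors 1, and -1 in [solve2], stand where chi(p) stood, so that the hypothesis
   matches [P] once [chi] is evaluated. *)
have solve1 (q x y z w : rat) : 1 < q ->
    (q - 1) * z = (y - 1) * x - (1 * y - 1 * q) * w ->
    z = (y - 1) / (q - 1) * x - (y - q) / (q - 1) * w.
  move=> q1 H; have q0 : q - 1 != 0 by rewrite subr_eq0 gt_eqF.
  by apply: (mulfI q0); rewrite H; field.
have solve2 (q x y z w e : rat) : 1 < q ->
    (q - -1) * z = (y - e) * x - (-1 * y - e * q) * w ->
    z = (y - e) / (q + 1) * x + (y + e * q) / (q + 1) * w.
  rewrite opprK => q1 H; have q0 : q + 1 != 0 by rewrite gt_eqF // addr_gt0 // (lt_trans ltr01).
  by apply: (mulfI q0); rewrite H; field.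
by split=> p3; have := P; rewrite p3 /chi p3 /= ?expr1n ?rmorph1 ?rmorphN1 => /(_ isT);
  [apply: solve1|apply: solve2].
Qed.
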